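(* Assume Case (I) or Case (II) holds (so $\mathcal A\neq\emptyset$). Consider either the ''consensus + projection'' flow (with $K>0$) with an arbitrary initial value $\mathbf x(0)$, or the ''projection consensus'' flow with an initial value satisfying $\mathbf x_i(0)\in\mathcal A_i$ for all $i$. Then: (i) If $\mathrm G_{\sigma(t)}$ is balanced for all $t\ge0$, i.e. $\sum_{j\in\mathrm N_i(t)}a_{ij}(t)=\sum_{j:\,i\in\mathrm N_j(t)}a_{ji}(t)$ for all $i\in\mathrm V$ and $t\ge0$, and $\mathrm G_{\sigma(t)}$ is either $\delta$-UJSC or $\delta$-BIJC for some $\delta>0$, then $\lim_{t\to\infty}\mathbf x_i(t)=\frac1N\sum_{j=1}^N\mathcal P_{\mathcal A}(\mathbf x_j(0))$ for all $i\in\mathrm V$. (ii) If $\mathrm G_{\sigma(t)}\equiv\mathrm G^{S}=(\mathrm V,\mathrm E^S)$ for a fixed strongly connected digraph and $a_{ij}(t)\equiv a_{ij}^{S}$ are positive constants, and $\mathbf w=(w_1,\dots,w_N)^T$ with $\sum_i w_i=1$ satisfies $\mathbf w^T\mathbf L^S=0$, where $\mathbf L^S=\mathbf D^S-\mathbf A^S$ with $\mathbf A^S=[\mathbb I_{(j,i)\in\mathrm E^S}a_{ij}^S]_{i,j}$ and $\mathbf D^S=\mathrm{diag}\big(\sum_j\mathbb I_{(j,i)\in\mathrm E^S}a_{ij}^S\big)_{i}$, then $\lim_{t\to\infty}\mathbf x_i(t)=\sum_{j=1}^N w_j\mathcal P_{\mathcal A}(\mathbf x_j(0))$ for all $i\in\mathrm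 V$.
   Context: Setting: $N,m\ge 1$; $\mathbf H\in\mathbb R^{N\times m}$ has rows $\mathbf h_1^{T},\dots,\mathbf h_N^{T}$ with $\|\mathbf h_i\|=1$ for all $i$; $\mathbf z=(z_1,\dots,z_N)^T\in\mathbb R^N$; the equation is $\mathbf z=\mathbf H\mathbf y$, $\mathbf y\in\mathbb R^m$. Let $\mathcal A_i=\{\mathbf y\in\mathbb R^m:\mathbf h_i^T\mathbf y=z_i\}$, $\mathcal A=\bigcap_{i=1}^N\mathcal A_i$, and for a closed convex set $\mathcal K$ let $\mathcal P_{\mathcal K}$ be the Euclidean projection onto $\mathcal K$ (so $\mathcal P_{\mathcal A_i}(\mathbf y)=(I-\mathbf h_i\mathbf h_i^T)\mathbf y+z_i\mathbf h_i$). Case (I): $\mathrm{rank}(\mathbf H)=m$ and $\mathbf z$ is in the column space of $\mathbf H$ (unique solution). Case (II): $\mathrm{rank}(\mathbf H)<m$ and $\mathbf z$ is in the column space of $\mathbf H$. Case (III): $\mathbf z$ is not in the column space of $\mathbf H$. Network: $\mathrm V=\{1,\dots,N\}$. A graph signal $\sigma$ assigns to each $t\ge0$ a directed graph $\mathrm G_{\sigma(t)}=(\mathrm V,\mathrm E_{\sigma(t)})$ whose arcs are ordered pairs of distinct nodes; $\mathrm N_i(t)=\{j:(j,i)\in\mathrm E_{\sigma(t)}\}$. For each ordered pair there is a weight function $a_{ij}:[0,\infty)\to(0,\infty)$. Weights Assumption: each $a_{ij}$ is continuous except on a set of Lebesgue measure zero, and there is $a^\ast>0$ with $a_{ij}(t)\le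 a^\ast$ for all $t,i,j$ (the functions $t\mapsto a_{ij}(t)\mathbb I_{(j,i)\in\mathrm E_{\sigma(t)}}$ are taken measurable). Connectivity: an arc $(j,i)$ is a $\delta$-arc on $[t_1,t_2)$ (possibly $t_2=\infty$) if $\int_{t_1}^{t_2}a_{ij}(t)\mathbb I_{(j,i)\in\mathrm E_{\sigma(t)}}dt\ge\delta$. $\mathrm G_{\sigma(t)}$ is $\delta$-uniformly jointly strongly connected ($\delta$-UJSC) if there is $T>0$ such that for every $s\ge0$ the $\delta$-arcs on $[s,s+T)$ form a strongly connected digraph on $\mathrm V$. $\mathrm G_{\sigma(t)}$ is $\delta$-bidirectionally infinitely jointly connected ($\delta$-BIJC) if $\mathrm G_{\sigma(t)}$ is bidirectional ($(i,j)\in\mathrm E_{\sigma(t)}\iff(j,i)\in\mathrm E_{\sigma(t)}$) for all $t$ and for every $s\ge0$ the $\delta$-arcs on $[s,\infty)$ form a connected graph. Flows (states $\mathbf x_i(t)\in\mathbb R^m$, $\mathbf x=(\mathbf x_1,\dots,\mathbf x_N)$, initial time $0$, absolutely continuous solutions): for $K>0$, the ''consensus + projection'' flow is $\dot{\mathbf x}_i=K\sum_{j\in\mathrm N_i(t)}a_{ij}(t)(\mathbf x_j-\mathbf x_i)+\mathcal P_{\mathcal A_i}(\mathbf x_i)-\mathbf x_i$, $i\in\mathrm V$; the ''projection consensus'' flow is $\dot{\mathbf x}_i=\sum_{j\in\mathrm N_i(t)}a_{ij}(t)\big(\mathcal P_{\mathcal A_i}(\mathbf x_j)-\mathcal P_{\mathcal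 A_i}(\mathbf x_i)\big)$, $i\in\mathrm V$. *)

(* Defs.v *)
(* Vectors of R^m are represented as
   functions nat -> R of which only the components k < m are ever inspected;
   agents are indexed by i < N (node i+1 of the paper is index i). *)
From Stdlib Require Import Reals Lra.
Open Scope R_scope.

Definition vec := nat -> R.

Fixpoint rsum (n : nat) (f : nat -> R) : R :=
  match n with O => 0 | S k => rsum k f + f k end.

Definition dot (m : nat) (u v : vec) : R := rsum m (fun k => u k * v k).
Definition vnorm (m : nat) (u : vec) : R := sqrt (dot m u u).
Definition vsub (u v : vec) : vec := fun k => u k - v k.

Definition inAi (m : nat) (h : nat -> vec) (z : nat -> R) (i : nat) (y : vec) : Prop :=
  dot m (h i) y = z i.
Definition inA (N m : nat) (h : nat -> vec) (z : nat -> R) (y : vec) : Prop :=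
  forall i, (i < N)%nat -> inAi m h z i y.

Definition projAi (m : nat) (h : nat -> vec) (z : nat -> R) (i : nat) (y : vec) : vec :=
  fun k => y k - dot m (h i) y * h i k + z i * h i k.

Definition is_proj (m : nat) (S : vec -> Prop) (y p : vec) : Prop :=
  S p /\ forall q, S q -> vnorm m (vsub y p) <= vnorm m (vsub y q).

Definition vec_lim (m : nat) (f : R -> vec) (l : vec) : Prop :=
  forall eps, eps > 0 -> exists T, forall t, t >= T -> vnorm m (vsub (f t) l) < eps.

Definition null_set (S : R -> Prop) : Prop :=
  forall eps, eps > 0 -> exists a b : nat -> R,
    (forall n, a n <= b n) /\
    (forall t, S t -> exists n, a n < t < b n) /\
    (forall n, sum_f_R0 (fun k => b k - a k) n <= eps).

Definition ae_pos (P : R -> Prop) : Prop := null_set (fun t => 0 < t /\ ~ P t).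

Definition abs_cont_on (f : R -> R) (a b : R) : Prop :=
  forall eps, eps > 0 -> exists d, d > 0 /\
    forall (n : nat) (l r : nat -> R),
      (forall k, (k < n)%nat -> a <= l k /\ l k <= r k /\ r k <= b) ->
      (forall k k', (k < k')%nat -> (k' < n)%nat -> r k <= l k') ->
      rsum n (fun k => r k - l k) < d ->
      rsum n (fun k => Rabs (f (r k) - f (l k))) < eps.

(* Graph signal: E t j i = true iff the arc (j,i) is in E_{sigma(t)};
   weights a i j t = a_ij(t).  States: x i t k = k-th component of x_i(t). *)

Definition cp_rhs (N m : nat) (h : nat -> vec) (z : nat -> R) (K : R)
  (E : R -> nat -> nat -> bool) (a : nat -> nat -> R -> R)
  (t : R) (x : nat -> vec) (i : nat) : vec :=
  fun k => K * rsum N (fun j => if E t j i then a i j t * (x j k - x i k) else 0)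
           + projAi m h z i (x i) k - x i k.

Definition pc_rhs (N m : nat) (h : nat -> vec) (z : nat -> R)
  (E : R -> nat -> nat -> bool) (a : nat -> nat -> R -> R)
  (t : R) (x : nat -> vec) (i : nat) : vec :=
  fun k => rsum N (fun j => if E t j i
                            then a i j t * (projAi m h z i (x j) k - projAi m h z i (x i) k)
                            else 0).

Definition is_solution (N m : nat)
  (rhs : R -> (nat -> vec) -> nat -> vec) (x : nat -> R -> vec) : Prop :=
  (forall i k, (i < N)%nat -> (k < m)%nat ->
     forall T, T >= 0 -> abs_cont_on (fun t => x i t k) 0 T) /\
  ae_pos (fun t => forall i k, (i < N)%nat -> (k < m)%nat ->
     derivable_pt_lim (fun s => x i s k) t (rhs t (fun j => x j t) i k)).

(* Henstock-Kurzweil integral of f over [a,b] equals I; for bounded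
   measurable (nonnegative) functions it coincides with the Lebesgue integral *)
Definition HK_integral (f : R -> R) (a b I : R) : Prop :=
  forall eps, eps > 0 -> exists gam : R -> R, (forall t, gam t > 0) /\
    forall (n : nat) (p xi : nat -> R),
      p O = a -> p n = b ->
      (forall k, (k < n)%nat ->
         p k <= xi k <= p (S k) /\ xi k - gam (xi k) < p k /\ p (S k) < xi k + gam (xi k)) ->
      Rabs (rsum n (fun k => f (xi k) * (p (S k) - p k)) - I) < eps.

Definition arcw (E : R -> nat -> nat -> bool) (a : nat -> nat -> R -> R) (j i : nat) : R -> R :=
  fun t => if E t j i then a i j t else 0.

Definition delta_arc (E : R -> nat -> nat -> bool) (a : nat -> nat -> R -> R)
  (delta t1 t2 : R) (j i : nat) : Prop :=
  exists I, HK_integral (arcw E a j i) t1 t2 I /\ I >= delta.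

(* (j,i) is a delta-arc on [t1,oo): the improper integral is >= delta *)
Definition delta_arc_inf (E : R -> nat -> nat -> bool) (a : nat -> nat -> R -> R)
  (delta t1 : R) (j i : nat) : Prop :=
  forall d', d' < delta -> exists T, T >= t1 /\ delta_arc E a d' t1 T j i.

Inductive reach (Rel : nat -> nat -> Prop) : nat -> nat -> Prop :=
| reach_refl : forall i, reach Rel i i
| reach_step : forall i j k, Rel i j -> reach Rel j k -> reach Rel i k.

Definition strongly_connected (N : nat) (Rel : nat -> nat -> Prop) : Prop :=
  forall i j, (i < N)%nat -> (j < N)%nat ->
    reach (fun u v => (u < N)%nat /\ (v < N)%nat /\ Rel u v) i j.

Definition connected (N : nat) (Rel : nat -> nat -> Prop) : Prop :=
  strongly_connected N (fun u v => Rel u v \/ Rel v u).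

Definition UJSC (N : nat) (E : R -> nat -> nat -> bool) (a : nat -> nat -> R -> R)
  (delta : R) : Prop :=
  exists T, T > 0 /\ forall s, s >= 0 ->
    strongly_connected N (fun j i => delta_arc E a delta s (s + T) j i).

Definition BIJC (N : nat) (E : R -> nat -> nat -> bool) (a : nat -> nat -> R -> R)
  (delta : R) : Prop :=
  (forall t i j, t >= 0 -> E t i j = E t j i) /\
  forall s, s >= 0 -> connected N (fun j i => delta_arc_inf E a delta s j i).

Definition balanced (N : nat) (E : R -> nat -> nat -> bool) (a : nat -> nat -> R -> R) : Prop :=
  forall i t, (i < N)%nat -> t >= 0 ->
    rsum N (fun j => if E t j i then a i j t else 0) =
    rsum N (fun j => if E t i j then a j i t else 0).

Definition adjS (ES : nat -> nat -> bool) (aS : nat -> nat -> R) (i j : nat) : R :=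
  if ES j i then aS i j else 0.
Definition laplS (N : nat) (ES : nat -> nat -> bool) (aS : nat -> nat -> R) (i j : nat) : R :=
  (if Nat.eqb i j then rsum N (fun k => adjS ES aS i k) else 0) - adjS ES aS i j.

(* Main.v *)
(* Both flows become one weight-balanced system: along ker H they act as plain
   consensus, and for q in A_i the squared distance |x_i - q|^2 has rate
   2 sum_j alpha_ij (x_i - q).(x_j - x_i) - 2 b_i^2, where b_i = h_i.x_i - z_i.
   In case (ii) the coefficients w_i a_ij are balanced and w > 0, so (i) and (ii)
   are the same statement with weights 1/N and w.

   With y* = sum_j w_j P_A(x_j(0)), the energy V = sum_i w_i |x_i - y*|^2 decays at rate
   sum_ij w_i alpha_ij |x_j - x_i|^2 + 2 sum_i w_i b_i^2; hence b_i -> 0.  As V is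
   nonincreasing, it is enough to find times at which all agents are close to each
   other: then they are close to A, and y* is the only possible limit because the
   ker H component of the weighted mean is conserved.

   Such times are found by merging clusters.  If the agents of each cluster are close
   at a late time, each cluster is near a common solution q of its own equations, and
   W = sum_i w_i |x_i - q_i|^2 grows at rate at most a constant times the total
   inter-cluster weight.  While distinct clusters stay theta apart, that weight is paid
   for by the decay of V, so W stays small; and since joint connectivity provides an
   inter-cluster arc of weight delta, the clusters cannot stay apart forever.  When two
   of them come within theta, they merge. *)
Require Import Defs.
From Stdlib Require Import Reals Lra Lia Classical IndefiniteDescription.
Open Scope R_scope.

(** * Finite sums *)

Lemma rsum_ext (n : nat) (f g : nat -> R) :
  (forall k, (k < n)%nat -> f k = g k) -> rsum n f = rsum n g.
Proof.
  induction n as [|n IH]; intros H; simpl; [reflexivity|].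
  rewrite IH, H; auto with arith.
Qed.

Lemma rsum_plus (n : nat) (f g : nat -> R) :
  rsum n (fun k => f k + g k) = rsum n f + rsum n g.
Proof. induction n as [|n IH]; simpl; [|rewrite IH]; ring. Qed.

Lemma rsum_minus (n : nat) (f g : nat -> R) :
  rsum n (fun k => f k - g k) = rsum n f - rsum n g.
Proof. induction n as [|n IH]; simpl; [|rewrite IH]; ring. Qed.

Lemma rsum_scal (n : nat) (c : R) (f : nat -> R) :
  rsum n (fun k => c * f k) = c * rsum n f.
Proof. induction n as [|n IH]; simpl; [|rewrite IH]; ring. Qed.

Lemma rsum_const (n : nat) (c : R) : rsum n (fun _ => c) = INR n * c.
Proof.
  induction n as [|n IH]; [simpl; ring|].
  rewrite S_INR; simpl; rewrite IH; ring.
Qed.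

Lemma rsum_le (n : nat) (f g : nat -> R) :
  (forall k, (k < n)%nat -> f k <= g k) -> rsum n f <= rsum n g.
Proof.
  induction n as [|n IH]; intros H; simpl; [lra|].
  apply Rplus_le_compat; auto with arith.
Qed.

Lemma rsum_0 (n : nat) (f : nat -> R) :
  (forall k, (k < n)%nat -> f k = 0) -> rsum n f = 0.
Proof.
  intros H; rewrite (rsum_ext n f (fun _ => 0)) by auto; rewrite rsum_const; ring.
Qed.

Lemma rsum_nonneg (n : nat) (f : nat -> R) :
  (forall k, (k < n)%nat -> 0 <= f k) -> 0 <= rsum n f.
Proof.
  intros H; rewrite <- (rsum_0 n (fun _ => 0)) by auto; now apply rsum_le.
Qed.

Lemma rsum_term_le (n : nat) (f : nat -> R) (i : nat) :
  (forall k, (k < n)%nat -> 0 <= f k) -> (i < n)%nat -> f i <= rsum n f.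
Proof.
  induction n as [|n IH]; intros H Hi; [lia|simpl].
  assert (0 <= rsum n f) by (apply rsum_nonneg; auto with arith).
  destruct (Nat.eq_dec i n) as [->|Hn]; [lra|].
  assert (f i <= rsum n f) by (apply IH; [auto with arith|lia]).
  specialize (H n (Nat.lt_succ_diag_r n)); lra.
Qed.

Lemma rsum_swap (n m : nat) (f : nat -> nat -> R) :
  rsum n (fun i => rsum m (fun j => f i j)) = rsum m (fun j => rsum n (fun i => f i j)).
Proof.
  induction n as [|n IH]; simpl.
  - symmetry; now apply rsum_0.
  - now rewrite IH, <- rsum_plus.
Qed.

Lemma rsum_shift (n : nat) (f : nat -> R) :
  rsum (S n) f = f O + rsum n (fun k => f (S k)).
Proof.
  induction n as [|n IH]; [simpl; ring|].
  change (rsum (S (S n)) f) with (rsum (S n) f + f (S n)).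
  rewrite IH; simpl; ring.
Qed.

Lemma rsum_telescope (n : nat) (f : nat -> R) :
  rsum n (fun k => f (S k) - f k) = f n - f O.
Proof. induction n as [|n IH]; simpl; [|rewrite IH]; ring. Qed.

Lemma rsum_abs (n : nat) (f : nat -> R) :
  Rabs (rsum n f) <= rsum n (fun k => Rabs (f k)).
Proof.
  induction n as [|n IH]; simpl; [rewrite Rabs_R0; lra|].
  eapply Rle_trans; [apply Rabs_triang|lra].
Qed.

Lemma sum_f_R0_rsum (n : nat) (f : nat -> R) : sum_f_R0 f n = rsum (S n) f.
Proof. induction n as [|n IH]; simpl in *; [ring|rewrite IH; ring]. Qed.

Lemma rsum_delta (n j : nat) (f : nat -> R) :
  (j < n)%nat -> rsum n (fun i => if Nat.eqb i j then f i else 0) = f j.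
Proof.
  induction n as [|n IH]; intros Hj; [lia|simpl].
  destruct (Nat.eq_dec j n) as [->|Hn].
  - rewrite Nat.eqb_refl, rsum_0; [ring|].
    intros k Hk; destruct (Nat.eqb_spec k n); [lia|reflexivity].
  - rewrite IH by lia; destruct (Nat.eqb_spec n j); [lia|ring].
Qed.

(** * Gauges and absolutely continuous functions *)

Definition fine_partition (gam : R -> R) (a b : R) (n : nat) (p xi : nat -> R) : Prop :=
  p O = a /\ p n = b /\
  forall k, (k < n)%nat ->
    p k <= xi k <= p (S k) /\ xi k - gam (xi k) < p k /\ p (S k) < xi k + gam (xi k).

Lemma fine_partition_extend (gam : R -> R) (a b c y : R) (n : nat) (p xi : nat -> R) :
  fine_partition gam a b n p xi -> b <= y <= c -> y - gam y < b -> c < y + gam y ->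
  exists p' xi', fine_partition gam a c (S n) p' xi'.
Proof.
  intros (H0 & Hn & H) Hy Hl Hr.
  exists (fun k => if Nat.leb k n then p k else c), (fun k => if Nat.ltb k n then xi k else y).
  split; [|split].
  - exact H0.
  - destruct (Nat.leb_spec (S n) n); [lia|reflexivity].
  - intros k Hk.
    destruct (Nat.leb_spec k n); [|lia].
    destruct (Nat.leb_spec (S k) n); destruct (Nat.ltb_spec k n); try lia.
    + now apply H.
    + assert (k = n) by lia; subst k; rewrite Hn; auto.
Qed.

(** Cousin's lemma by a supremum argument. If [c] is the supremum of the right ends that fine
    partitions can reach, one of them ends within [gam c] of [c], and a further cell tagged [c]
    carries it past [c] unless [c] is already [b]. *)
Lemma cousin (gam : R -> R) (a b : R) :
  (forall t, gam t > 0) -> a <= b -> exists n p xi, fine_partition gam a b n p xi.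
Proof.
  intros Hg Hab.
  set (E := fun u => a <= u <= b /\ exists n p xi, fine_partition gam a u n p xi).
  assert (Ea : E a).
  { split; [lra|]. exists O, (fun _ => a), (fun _ => a). repeat split; intros; lia. }
  destruct (completeness E) as [c [Hub Hlub]].
  - exists b; intros u [Hu _]; lra.
  - now exists a.
  - assert (Hac : a <= c) by now apply Hub.
    assert (Hcb : c <= b) by (apply Hlub; intros u [Hu _]; lra).
    assert (Hnear : exists u, E u /\ c - gam c < u).
    { apply NNPP; intros Hno.
      assert (c <= c - gam c); [|specialize (Hg c); lra].
      apply Hlub; intros u Hu; apply Rnot_lt_le; intros Hlt; apply Hno; now exists u. }
    destruct Hnear as [u [[Hu (n & p & xi & Hf)] Hcu]].
    assert (Huc : u <= c) by (apply Hub; split; [lra|now exists n, p, xi]).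
    pose proof (Hg c) as Hgc.
    (* The extended partition ends at [v], so [v <= c]; as [c + gam c / 2] exceeds [c], the minimum
       must be [b]. *)
    set (v := Rmin b (c + gam c / 2)).
    assert (Hv : c <= v <= b /\ v < c + gam c).
    { unfold v, Rmin; destruct (Rle_dec b (c + gam c / 2)); lra. }
    destruct (fine_partition_extend gam a u v c n p xi Hf) as (p' & xi' & Hf'); try lra.
    assert (Hvc : v <= c).
    { apply Hub; split; [lra|now exists (S n), p', xi']. }
    assert (Hvb : v = b).
    { unfold v, Rmin in *; destruct (Rle_dec b (c + gam c / 2)); lra. }
    rewrite <- Hvb; now exists (S n), p', xi'.
Qed.

Lemma fine_partition_mono (gam : R -> R) (a b : R) (n : nat) (p xi : nat -> R) (j k : nat) :
  fine_partition gam a b n p xi -> (j <= k)%nat -> (k <= n)%nat -> p j <= p k.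
Proof.
  intros (_ & _ & H) Hjk; induction Hjk as [|k Hjk IH]; intros Hk; [lra|].
  destruct (H k) as [Hx _]; [lia|]. specialize (IH ltac:(lia)); lra.
Qed.

Lemma HK_integral_const (f : R -> R) (c a b : R) :
  (forall t, a <= t <= b -> f t = c) -> HK_integral f a b (c * (b - a)).
Proof.
  intros Hf eps Heps; exists (fun _ => 1); split; [intros; lra|].
  intros n p xi H0 Hn H.
  assert (Hfp : fine_partition (fun _ => 1) a b n p xi) by (repeat split; auto; now apply H).
  rewrite (rsum_ext n _ (fun k => c * (p (S k) - p k))).
  - rewrite rsum_scal, rsum_telescope, H0, Hn, Rminus_diag, Rabs_R0; exact Heps.
  - intros k Hk; rewrite Hf; [reflexivity|].
    destruct (H k Hk) as [Hx _].
    pose proof (fine_partition_mono _ _ _ _ _ _ O k Hfp ltac:(lia) ltac:(lia)).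
    pose proof (fine_partition_mono _ _ _ _ _ _ (S k) n Hfp ltac:(lia) ltac:(lia)).
    lra.
Qed.

Lemma HK_integral_scal (f : R -> R) (c a b I : R) :
  HK_integral f a b I -> HK_integral (fun t => c * f t) a b (c * I).
Proof.
  intros H eps Heps.
  assert (Hc : 0 < Rabs c + 1) by (pose proof (Rabs_pos c); lra).
  destruct (H (eps / (Rabs c + 1))) as [gam [Hg HI]]; [now apply Rdiv_lt_0_compat|].
  exists gam; split; [exact Hg|]; intros n p xi H0 Hn Hp.
  specialize (HI n p xi H0 Hn Hp).
  rewrite (rsum_ext n _ (fun k => c * (f (xi k) * (p (S k) - p k)))) by (intros; ring).
  rewrite rsum_scal, <- Rmult_minus_distr_l, Rabs_mult.
  set (y := Rabs (_ - I)) in *.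
  assert (0 <= y) by apply Rabs_pos.
  apply Rle_lt_trans with ((Rabs c + 1) * y); [nra|].
  apply Rmult_lt_compat_l with (r := Rabs c + 1) in HI; [|exact Hc].
  replace ((Rabs c + 1) * (eps / (Rabs c + 1))) with eps in HI by (field; lra).
  exact HI.
Qed.

Lemma null_set_insert (Z : R -> Prop) (c : R) :
  null_set Z -> null_set (fun t => Z t \/ t = c).
Proof.
  intros H eps Heps; destruct (H (eps / 2)) as (a & b & Hab & Hc & Hs); [lra|].
  exists (fun n => match n with O => c - eps / 4 | S k => a k end),
         (fun n => match n with O => c + eps / 4 | S k => b k end).
  split; [|split].
  - intros [|n]; [lra|auto].
  - intros t [Ht| ->]; [|exists O; lra].
    destruct (Hc t Ht) as [n Hn]; now exists (S n).
  - intros n; rewrite sum_f_R0_rsum, rsum_shift.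
    destruct n as [|n]; simpl rsum at 1; [lra|].
    specialize (Hs n); rewrite sum_f_R0_rsum in Hs; simpl in *; lra.
Qed.

(* The nondecreasing map [u |-> sum_i clamp(u; a_i, b_i)] grows at least as fast
   as the identity on each covered interval. *)
Lemma covered_length_le (a b p r : nat -> R) (n : nat) :
  (forall k, a k <= b k) ->
  (forall k, (k < n)%nat -> p k <= r k <= p (S k)) ->
  (forall k, (k < n)%nat -> r k = p k \/ exists j, a j < p k /\ r k < b j) ->
  exists M, rsum n (fun k => r k - p k) <= rsum M (fun j => b j - a j).
Proof.
  intros Hab Hp Hc.
  set (cl := fun j u => Rmin (b j) (Rmax (a j) u)).
  assert (Hmono : forall j u v, u <= v -> cl j u <= cl j v).
  { intros j u v Huv; unfold cl, Rmin, Rmax.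
    repeat destruct (Rle_dec _ _); lra. }
  assert (Hrange : forall j u, a j <= cl j u <= b j).
  { intros j u; specialize (Hab j); unfold cl, Rmin, Rmax; repeat destruct (Rle_dec _ _); lra. }
  assert (HM : exists M, rsum n (fun k => r k - p k)
                         <= rsum M (fun j => cl j (p n) - cl j (p O))).
  { induction n as [|n IH]; [exists O; simpl; lra|].
    destruct IH as [M HM]; [auto with arith|auto with arith|].
    assert (Hrp := Hp n (Nat.lt_succ_diag_r n)).
    destruct (Hc n (Nat.lt_succ_diag_r n)) as [He|[j [Haj Hbj]]].
    - exists M; simpl. rewrite He, Rminus_diag, Rplus_0_r.
      eapply Rle_trans; [exact HM|apply rsum_le; intros j _].
      assert (cl j (p n) <= cl j (p (S n))) by (apply Hmono; lra); lra.
    - exists (Nat.max M (S j)); simpl.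
      set (M' := Nat.max M (S j)).
      assert (H1 : rsum n (fun k => r k - p k) <= rsum M' (fun j => cl j (p n) - cl j (p O))).
      { eapply Rle_trans; [exact HM|].
        assert (HMM : (M <= M')%nat) by lia.
        assert (Hpn : p O <= p n).
        { clear - Hp. induction n as [|n IH]; [lra|].
          assert (p O <= p n) by (apply IH; auto with arith).
          specialize (Hp n ltac:(lia)); lra. }
        clear - HMM Hmono Hpn; induction HMM as [|M' _ IH]; [lra|simpl].
        specialize (Hmono M' _ _ Hpn); lra. }
      assert (H2 : r n - p n <= rsum M' (fun j => cl j (p (S n)) - cl j (p n))).
      { eapply Rle_trans; [|apply (rsum_term_le M' (fun j => cl j (p (S n)) - cl j (p n)) j)].
        - assert (cl j (r n) <= cl j (p (S n))) by (apply Hmono; lra).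
          assert (cl j (p n) = p n) by (unfold cl, Rmin, Rmax; repeat destruct (Rle_dec _ _); lra).
          assert (cl j (r n) = r n) by (unfold cl, Rmin, Rmax; repeat destruct (Rle_dec _ _); lra).
          lra.
        - intros k _; specialize (Hmono k (p n) (p (S n)) ltac:(lra)); lra.
        - lia. }
      rewrite !rsum_minus in *; lra. }
  destruct HM as [M HM]; exists M; eapply Rle_trans; [exact HM|].
  apply rsum_le; intros j _.
  pose proof (Hrange j (p n)); pose proof (Hrange j (p O)); lra.
Qed.

(* A gauge argument: tags in the exceptional null set are charged to absolute
   continuity, all others to the derivative bound.  This needs neither Lebesgue's
   differentiation theorem nor integrability of the derivative. *)
Lemma ac_increment_le (f g : R -> R) (P : R -> Prop) (T s t I B : R) :
  abs_cont_on f 0 T -> 0 <= s -> s <= t -> t <= T -> ae_pos P ->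
  (forall u, s < u < t -> P u -> exists d, derivable_pt_lim f u d /\ d <= g u) ->
  (forall u, s <= u <= t -> Rabs (g u) <= B) ->
  HK_integral g s t I -> f t - f s <= I.
Proof.
  intros Hac Hs Hst HtT Hae Hder HB HI.
  assert (HB0 : 0 <= B).
  { eapply Rle_trans; [apply Rabs_pos|apply (HB s); lra]. }
  assert (Hkey : forall e, e > 0 -> f t - f s <= I + e * (2 + (t - s) + B)).
  { intros e He.
    destruct (Hac e He) as [d [Hd HAC]].
    (* Bad cells of total length below [d1] cost less than [e] in the variation of [f] and at most
       [B * e] in the sum for [g]. *)
    set (d1 := Rmin d e).
    assert (Hd1 : 0 < d1 /\ d1 <= d /\ d1 <= e).
    { unfold d1, Rmin; destruct (Rle_dec d e); lra. }
    destruct (HI e He) as [gam [Hgam HK]].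
    (* The endpoints join the exceptional set because the derivative bound is assumed only strictly
       between [s] and [t], while tags may sit at the ends. *)
    destruct (null_set_insert _ t (null_set_insert _ s Hae) (d1 / 2)) as (a & b & Hab & Hcov & Hlen);
      [lra|].
    (* The gauge [gm] refines [gam]. Around a bad tag it keeps the cell inside one covering
       interval; around a good tag it bounds the increment of [f] over the cell. *)
    destruct (functional_choice
      (fun (u gm : R) => gm > 0 /\ gm <= gam u /\
         (s <= u <= t ->
            (exists j, forall v, Rabs (v - u) < gm -> a j < v < b j) \/
            (forall v w, v <= u <= w -> u - gm < v -> w < u + gm ->
               f w - f v <= (g u + e) * (w - v)))))
      as [gm Hgm].
    { intros u.
      destruct (classic ((0 < u /\ ~ P u) \/ u = s \/ u = t)) as [Hbad|Hgood].
      - destruct (Hcov u) as [j Hj]; [tauto|].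
        set (r := Rmin (u - a j) (b j - u)).
        assert (Hr : 0 < r /\ r <= u - a j /\ r <= b j - u).
        { unfold r, Rmin; destruct (Rle_dec (u - a j) (b j - u)); lra. }
        exists (Rmin r (gam u)); specialize (Hgam u).
        assert (Hm : 0 < Rmin r (gam u) /\ Rmin r (gam u) <= r /\ Rmin r (gam u) <= gam u).
        { unfold Rmin; destruct (Rle_dec r (gam u)); lra. }
        split; [lra|split; [lra|]]. intros _; left; exists j; intros v Hv.
        apply Rabs_def2 in Hv; lra.
      - destruct (classic (s <= u <= t)) as [Hu|Hu].
        + assert (HP : P u).
          { apply NNPP; intros HnP; apply Hgood; left; split; [|exact HnP].
            destruct (Req_dec u s); [tauto|lra]. }
          destruct (Hder u) as [d' [Hd' Hle]]; [|exact HP|].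
          { split; apply Rnot_le_lt; intros Hc; apply Hgood; right; [left|right]; lra. }
          destruct (Hd' e He) as [dl Hdl].
          exists (Rmin dl (gam u)); specialize (Hgam u).
          pose proof (cond_pos dl) as Hdlp.
          assert (Hm : 0 < Rmin dl (gam u) /\ Rmin dl (gam u) <= dl /\ Rmin dl (gam u) <= gam u).
          { unfold Rmin; destruct (Rle_dec dl (gam u)); lra. }
          split; [lra|split; [lra|]]. intros _; right.
          (* Straddle estimate: the differentiability bounds on the two sides of the tag [u] add up
             to a bound over any [[v, w]] containing [u]. *)
          assert (Hloc : forall k, Rabs k < dl -> Rabs (f (u + k) - f u - d' * k) <= e * Rabs k).
          { intros k Hk. destruct (Req_dec k 0) as [->|Hk0].
            - rewrite Rplus_0_r, Rabs_R0.
              replace (f u - f u - d' * 0) with 0 by ring; rewrite Rabs_R0; lra.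
            - specialize (Hdl k Hk0 Hk).
              replace (f (u + k) - f u - d' * k) with (((f (u + k) - f u) / k - d') * k)
                by (field; exact Hk0).
              rewrite Rabs_mult. apply Rmult_le_compat_r; [apply Rabs_pos|lra]. }
          intros v w Hvw Hv Hw.
          assert (H1 := Hloc (w - u) ltac:(apply Rabs_def1; lra)).
          assert (H2 := Hloc (v - u) ltac:(apply Rabs_def1; lra)).
          replace (u + (w - u)) with w in H1 by ring.
          replace (u + (v - u)) with v in H2 by ring.
          rewrite (Rabs_pos_eq (w - u)) in H1 by lra.
          rewrite (Rabs_left1 (v - u)) in H2 by lra.
          pose proof (Rle_abs (f w - f u - d' * (w - u))).
          pose proof (Rle_abs (- (f v - f u - d' * (v - u)))) as H4; rewrite Rabs_Ropp in H4.
          assert (d' * (w - v) <= g u * (w - v)) by (apply Rmult_le_compat_r; lra).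
          lra.
        + exists (gam u); split; [apply Hgam|split; [lra|tauto]]. }
    destruct (cousin gm s t) as (n & p & xi & Hfp); [intros; apply Hgm|exact Hst|].
    pose proof Hfp as (Hp0 & Hpn & Hp).
    assert (Hin : forall k, (k < n)%nat -> s <= xi k <= t).
    { intros k Hk; destruct (Hp k Hk) as [Hx _].
      pose proof (fine_partition_mono _ _ _ _ _ _ O k Hfp ltac:(lia) ltac:(lia)).
      pose proof (fine_partition_mono _ _ _ _ _ _ (S k) n Hfp ltac:(lia) ltac:(lia)).
      lra. }
    assert (HKs : rsum n (fun k => g (xi k) * (p (S k) - p k)) <= I + e).
    { assert (Hk := HK n p xi Hp0 Hpn).
      match type of Hk with ?X -> _ => assert (HX : X) end.
      { intros k Hk'; destruct (Hp k Hk') as (H1 & H2 & H3); destruct (Hgm (xi k)) as (_ & H4 & _).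
        repeat split; lra. }
      specialize (Hk HX); apply Rabs_def2 in Hk; lra. }
    (* [[p k, r k]] is the bad part of cell [k]: the whole cell if its tag is bad, a single point
       otherwise. One inequality then covers both kinds of cells. *)
    destruct (functional_choice
      (fun k r => (k < n)%nat ->
         p k <= r <= p (S k) /\ (r = p k \/ exists j, a j < p k /\ r < b j) /\
         f (p (S k)) - f (p k) <= g (xi k) * (p (S k) - p k) + e * (p (S k) - p k)
                                  + Rabs (f r - f (p k)) + B * (r - p k))) as [r Hr].
    { intros k. destruct (classic (k < n)%nat) as [Hk|Hk]; [|exists 0; tauto].
      destruct (Hp k Hk) as (Hx & Hl & Hu).
      destruct (Hgm (xi k)) as (Hg0 & _ & Hcase).
      destruct (Hcase (Hin k Hk)) as [[j Hj]|Hgood].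
      - exists (p (S k)); intros _; split; [lra|split].
        + right; exists j; split; apply Hj; apply Rabs_def1; lra.
        + pose proof (Rle_abs (f (p (S k)) - f (p k))).
          pose proof (HB (xi k) (Hin k Hk)).
          pose proof (Rle_abs (- g (xi k))) as H2; rewrite Rabs_Ropp in H2.
          assert (0 <= (B + g (xi k)) * (p (S k) - p k)) by (apply Rmult_le_pos; lra).
          assert (0 <= e * (p (S k) - p k)) by (apply Rmult_le_pos; lra).
          lra.
      - exists (p k); intros _; split; [lra|split; [now left|]].
        rewrite !Rminus_diag, Rabs_R0.
        specialize (Hgood (p k) (p (S k)) Hx Hl Hu); lra. }
    assert (Hbad : rsum n (fun k => r k - p k) < d1).
    { destruct (covered_length_le a b p r n) as [M HM]; auto.
      - intros k Hk; now apply Hr.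
      - intros k Hk; now apply Hr.
      - eapply Rle_lt_trans; [exact HM|].
        specialize (Hlen M); rewrite sum_f_R0_rsum in Hlen; simpl in Hlen.
        specialize (Hab M); lra. }
    assert (Hacs : rsum n (fun k => Rabs (f (r k) - f (p k))) < e).
    { apply HAC; [| |lra].
      - intros k Hk; destruct (Hr k Hk) as [Hrk _].
        pose proof (fine_partition_mono _ _ _ _ _ _ O k Hfp ltac:(lia) ltac:(lia)).
        pose proof (fine_partition_mono _ _ _ _ _ _ (S k) n Hfp ltac:(lia) ltac:(lia)).
        lra.
      - intros k k' Hkk Hk'; destruct (Hr k ltac:(lia)) as [Hrk _].
        pose proof (fine_partition_mono _ _ _ _ _ _ (S k) k' Hfp ltac:(lia) ltac:(lia)).
        lra. }
    assert (Htot : f t - f s <= rsum n (fun k => g (xi k) * (p (S k) - p k) + e * (p (S k) - p k)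
                                  + Rabs (f (r k) - f (p k)) + B * (r k - p k))).
    { rewrite <- Hp0, <- Hpn, <- (rsum_telescope n (fun k => f (p k))).
      apply rsum_le; intros k Hk; now apply Hr. }
    rewrite !rsum_plus, !rsum_scal, rsum_telescope, Hp0, Hpn in Htot.
    assert (B * rsum n (fun k => r k - p k) <= B * e) by (apply Rmult_le_compat_l; lra).
    lra. }
  apply Rnot_lt_le; intros Hlt.
  assert (Hc : 0 < 2 + (t - s) + B) by lra.
  assert (He : 0 < (f t - f s - I) / (2 * (2 + (t - s) + B))).
  { apply Rdiv_lt_0_compat; lra. }
  specialize (Hkey _ He).
  replace ((f t - f s - I) / (2 * (2 + (t - s) + B)) * (2 + (t - s) + B))
    with ((f t - f s - I) / 2) in Hkey by (field; lra).
  lra.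
Qed.

(** * Locally absolutely continuous functions on the half-line *)

Definition loc_ac (f : R -> R) : Prop := forall T, T >= 0 -> abs_cont_on f 0 T.

Lemma loc_ac_le (f g : R -> R) (c : R) :
  loc_ac f -> (forall T, T >= 0 -> forall u v, 0 <= u <= T -> 0 <= v <= T ->
    Rabs (g v - g u) <= c * Rabs (f v - f u)) -> loc_ac g.
Proof.
  intros Hf Hg T HT e He.
  assert (Hc : 0 < Rabs c + 1) by (pose proof (Rabs_pos c); lra).
  destruct (Hf T HT (e / (Rabs c + 1))) as [d [Hd H]]; [now apply Rdiv_lt_0_compat|].
  exists d; split; [exact Hd|]; intros n l r Hlr Hs Hsum.
  specialize (H n l r Hlr Hs Hsum).
  apply Rmult_lt_compat_l with (r := Rabs c + 1) in H; [|exact Hc].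
  replace ((Rabs c + 1) * (e / (Rabs c + 1))) with e in H by (field; lra).
  eapply Rle_lt_trans; [|exact H].
  rewrite <- rsum_scal; apply rsum_le; intros k Hk.
  destruct (Hlr k Hk) as (H1 & H2 & H3).
  eapply Rle_trans; [apply (Hg T HT); lra|].
  apply Rmult_le_compat_r; [apply Rabs_pos|]; pose proof (Rle_abs c); lra.
Qed.

Lemma loc_ac_plus (f g : R -> R) : loc_ac f -> loc_ac g -> loc_ac (fun t => f t + g t).
Proof.
  intros Hf Hg T HT e He.
  destruct (Hf T HT (e / 2)) as [d1 [Hd1 H1]]; [lra|].
  destruct (Hg T HT (e / 2)) as [d2 [Hd2 H2]]; [lra|].
  exists (Rmin d1 d2); split; [now apply Rmin_pos|]; intros n l r Hlr Hs Hsum.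
  pose proof (Rmin_l d1 d2); pose proof (Rmin_r d1 d2).
  specialize (H1 n l r Hlr Hs ltac:(lra)); specialize (H2 n l r Hlr Hs ltac:(lra)).
  apply Rle_lt_trans with (rsum n (fun k => Rabs (f (r k) - f (l k)) + Rabs (g (r k) - g (l k)))).
  - apply rsum_le; intros k _.
    replace (f (r k) + g (r k) - (f (l k) + g (l k)))
      with ((f (r k) - f (l k)) + (g (r k) - g (l k))) by ring.
    apply Rabs_triang.
  - rewrite rsum_plus; lra.
Qed.

Lemma loc_ac_const (c : R) : loc_ac (fun _ => c).
Proof.
  intros T _ e He; exists 1; split; [lra|]; intros n l r _ _ _.
  rewrite rsum_0; [exact He|]; intros; rewrite Rminus_diag, Rabs_R0; reflexivity.
Qed.

Lemma loc_ac_scal (c : R) (f : R -> R) : loc_ac f -> loc_ac (fun t => c * f t).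
Proof.
  intros Hf; apply (loc_ac_le f _ (Rabs c)); [exact Hf|]; intros T _ u v _ _.
  rewrite <- Rmult_minus_distr_l, Rabs_mult; lra.
Qed.

Lemma loc_ac_rsum (n : nat) (f : nat -> R -> R) :
  (forall k, (k < n)%nat -> loc_ac (f k)) -> loc_ac (fun t => rsum n (fun k => f k t)).
Proof.
  induction n as [|n IH]; intros H; simpl; [apply loc_ac_const|].
  apply loc_ac_plus; auto with arith.
Qed.

Lemma loc_ac_unif_cont (f : R -> R) (T e : R) :
  loc_ac f -> T >= 0 -> e > 0 ->
  exists d, d > 0 /\ forall u v, 0 <= u <= T -> 0 <= v <= T -> Rabs (v - u) < d ->
    Rabs (f v - f u) < e.
Proof.
  intros Hf HT He; destruct (Hf T HT e He) as [d [Hd H]].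
  exists d; split; [exact Hd|].
  assert (Hle : forall u v, 0 <= u <= T -> 0 <= v <= T -> u <= v -> v - u < d ->
    Rabs (f v - f u) < e).
  { intros u v Hu Hv Huv Hd'.
    specialize (H 1%nat (fun _ => u) (fun _ => v)); simpl in H.
    rewrite !Rplus_0_l in H; apply H; [intros; lra|intros; lia|exact Hd']. }
  intros u v Hu Hv Huv; apply Rabs_def2 in Huv.
  destruct (Rle_dec u v); [apply Hle; lra|].
  rewrite Rabs_minus_sym; apply Hle; lra.
Qed.

(** By uniform continuity [f] changes by less than 1 over a step of length [d / 2], and finitely
    many such steps lead from 0 to any point of [[0, T]]. *)
Lemma loc_ac_bounded (f : R -> R) (T : R) :
  loc_ac f -> T >= 0 -> exists B, forall u, 0 <= u <= T -> Rabs (f u) <= B.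
Proof.
  intros Hf HT; destruct (loc_ac_unif_cont f T 1 Hf HT) as [d [Hd H]]; [lra|].
  assert (Hn : forall n u, 0 <= u <= T -> u <= INR n * (d / 2) ->
            Rabs (f u) <= Rabs (f 0) + INR n).
  { induction n as [|n IH]; intros u Hu Hun.
    - simpl in *; assert (u = 0) by lra; subst u; lra.
    - rewrite S_INR in *.
      set (v := Rmax 0 (u - d / 2)).
      assert (Hv : 0 <= v <= u /\ u - v < d /\ v <= INR n * (d / 2)).
      { pose proof (pos_INR n); unfold v, Rmax; destruct (Rle_dec 0 (u - d / 2)); nra. }
      specialize (IH v ltac:(lra) ltac:(lra)).
      specialize (H v u ltac:(lra) Hu ltac:(apply Rabs_def1; lra)).
      pose proof (Rabs_triang (f u - f v) (f v)) as H1.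
      replace (f u - f v + f v) with (f u) in H1 by ring; lra. }
  destruct (INR_unbounded (T / (d / 2))) as [n Hn'].
  exists (Rabs (f 0) + INR n); intros u Hu; apply Hn; [exact Hu|].
  apply Rmult_lt_compat_r with (r := d / 2) in Hn'; [|lra].
  replace (T / (d / 2) * (d / 2)) with T in Hn' by (field; lra); lra.
Qed.

(** The Lipschitz constant of squaring depends on the bound of [f] on [[0, T]], hence on [T], so
    [loc_ac_le] with its single constant does not apply. *)
Lemma loc_ac_sqr (f : R -> R) : loc_ac f -> loc_ac (fun t => f t * f t).
Proof.
  intros Hf T HT.
  destruct (loc_ac_bounded f T Hf HT) as [B HB].
  assert (HB0 : 0 <= B) by (eapply Rle_trans; [apply Rabs_pos|apply (HB 0); lra]).
  intros e He.
  destruct (Hf T HT (e / (2 * B + 1))) as [d [Hd H]]; [apply Rdiv_lt_0_compat; lra|].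
  exists d; split; [exact Hd|]; intros n l r Hlr Hs Hsum.
  specialize (H n l r Hlr Hs Hsum).
  apply Rmult_lt_compat_l with (r := 2 * B + 1) in H; [|lra].
  replace ((2 * B + 1) * (e / (2 * B + 1))) with e in H by (field; lra).
  eapply Rle_lt_trans; [|exact H].
  rewrite <- rsum_scal; apply rsum_le; intros k Hk.
  destruct (Hlr k Hk) as (H1 & H2 & H3).
  replace (f (r k) * f (r k) - f (l k) * f (l k))
    with ((f (r k) + f (l k)) * (f (r k) - f (l k))) by ring.
  rewrite Rabs_mult; apply Rmult_le_compat_r; [apply Rabs_pos|].
  eapply Rle_trans; [apply Rabs_triang|].
  pose proof (HB (r k) ltac:(lra)); pose proof (HB (l k) ltac:(lra)); lra.
Qed.

Lemma ac_increment_le_const (f : R -> R) (P : R -> Prop) (s t c : R) :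
  loc_ac f -> ae_pos P -> 0 <= s -> s <= t ->
  (forall u, s < u < t -> P u -> exists d, derivable_pt_lim f u d /\ d <= c) ->
  f t - f s <= c * (t - s).
Proof.
  intros Hf HP Hs Hst Hd.
  apply (ac_increment_le f (fun _ => c) P t s t _ (Rabs c)); auto; try lra.
  - apply Hf; lra.
  - intros; lra.
  - now apply HK_integral_const.
Qed.

(** The source of both conservation laws below: the invariance of each [A_i] under projection
    consensus, and that of the weighted mean along the kernel. *)
Lemma ac_constant (f : R -> R) (P : R -> Prop) (t : R) :
  loc_ac f -> ae_pos P -> 0 <= t ->
  (forall u, 0 < u -> P u -> derivable_pt_lim f u 0) -> f t = f 0.
Proof.
  intros Hf HP Ht Hd.
  assert (H1 : f t - f 0 <= 0 * (t - 0)).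
  { apply (ac_increment_le_const f P); auto; try lra.
    intros u Hu HPu; exists 0; split; [apply Hd; [lra|exact HPu]|lra]. }
  assert (H2 : - 1 * f t - - 1 * f 0 <= 0 * (t - 0)).
  { apply (ac_increment_le_const (fun u => - 1 * f u) P); auto; try lra.
    - now apply loc_ac_scal.
    - intros u Hu HPu; exists (- 1 * 0); split; [|lra].
      apply derivable_pt_lim_scal, Hd; [lra|exact HPu]. }
  lra.
Qed.

(** * Derivatives of sums, finite uniformity, first times and monotone limits *)

Lemma derivable_pt_lim_rsum (n : nat) (f : nat -> R -> R) (d : nat -> R) (t : R) :
  (forall k, (k < n)%nat -> derivable_pt_lim (f k) t (d k)) ->
  derivable_pt_lim (fun s => rsum n (fun k => f k s)) t (rsum n d).
Proof.
  induction n as [|n IH]; intros H; simpl; [apply derivable_pt_lim_const|].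
  apply (derivable_pt_lim_plus (fun s => rsum n (fun k => f k s)) (f n)); auto with arith.
Qed.

Lemma derivable_pt_lim_eq (f : R -> R) (t d d' : R) :
  derivable_pt_lim f t d -> d = d' -> derivable_pt_lim f t d'.
Proof. now intros H <-. Qed.

(** The minimum of finitely many radii serves. Besides radii in time, this also yields a positive
    lower bound for the weights. *)
Lemma uniform_radius (n : nat) (Q : nat -> R -> Prop) :
  (forall i d d', d' <= d -> Q i d -> Q i d') ->
  (forall i, (i < n)%nat -> exists d, d > 0 /\ Q i d) ->
  exists d, d > 0 /\ forall i, (i < n)%nat -> Q i d.
Proof.
  intros Hm; induction n as [|n IH]; intros H; [exists 1; split; [lra|lia]|].
  destruct IH as [d1 [Hd1 H1]]; [auto with arith|].
  destruct (H n) as [d2 [Hd2 H2]]; [lia|].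
  exists (Rmin d1 d2); split; [now apply Rmin_pos|]; intros i Hi.
  destruct (Nat.eq_dec i n) as [->|Hn].
  - eapply Hm; [apply Rmin_r|exact H2].
  - eapply Hm; [apply Rmin_l|apply H1; lia].
Qed.

Lemma uniform_time (n : nat) (Q : nat -> R -> Prop) :
  (forall i, (i < n)%nat -> exists T, forall t, t >= T -> Q i t) ->
  exists T, forall t, t >= T -> forall i, (i < n)%nat -> Q i t.
Proof.
  induction n as [|n IH]; intros H; [exists 0; lia|].
  destruct IH as [T1 H1]; [auto with arith|].
  destruct (H n) as [T2 H2]; [lia|].
  exists (Rmax T1 T2); intros t Ht i Hi.
  pose proof (Rmax_l T1 T2); pose proof (Rmax_r T1 T2).
  destruct (Nat.eq_dec i n) as [->|Hn]; [apply H2; lra|apply H1; [lra|lia]].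
Qed.

(** The last hypothesis makes [C] relatively closed in [[s, t0]], so its infimum there is attained.
    That infimum is obtained as the supremum of the times before which [C] has not occurred. *)
Lemma first_time (C : R -> Prop) (s t0 : R) :
  s <= t0 -> C t0 ->
  (forall t, s <= t <= t0 -> ~ C t ->
     exists d, d > 0 /\ forall u, s <= u <= t0 -> Rabs (u - t) < d -> ~ C u) ->
  exists t1, s <= t1 /\ C t1 /\ forall t, s <= t < t1 -> ~ C t.
Proof.
  intros Hs HC Hopen.
  set (E := fun u => s <= u <= t0 /\ forall t, s <= t < u -> ~ C t).
  destruct (completeness E) as [c [Hub Hlub]].
  - exists t0; intros u [Hu _]; lra.
  - exists s; split; [lra|intros; lra].
  - assert (Hsc : s <= c) by (apply Hub; split; [lra|intros; lra]).
    assert (Hct : c <= t0) by (apply Hlub; intros u [Hu _]; lra).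
    assert (Hbefore : forall t, s <= t < c -> ~ C t).
    { intros t Ht HCt. assert (c <= t); [|lra].
      apply Hlub; intros u [Hu HuC]; apply Rnot_lt_le; intros Htu.
      apply (HuC t); [lra|exact HCt]. }
    exists c; split; [exact Hsc|split; [|exact Hbefore]].
    apply NNPP; intros HnC.
    destruct (Hopen c) as [d [Hd Hd']]; [lra|exact HnC|].
    assert (Hne : c < t0) by (destruct (Req_dec c t0); [subst c; tauto|lra]).
    set (v := Rmin t0 (c + d)).
    assert (Hv : c < v /\ v <= t0 /\ v <= c + d).
    { unfold v, Rmin; destruct (Rle_dec t0 (c + d)); lra. }
    assert (v <= c); [|lra].
    apply Hub; split; [lra|]; intros t Ht.
    destruct (Rlt_dec t c); [apply Hbefore; lra|].
    apply Hd'; [lra|apply Rabs_def1; lra].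
Qed.

(** Applied to the energy, it says that after a late time only an arbitrarily small amount of energy
    is left to be dissipated; every later argument spends against this budget. *)
Lemma nonincreasing_cauchy (V : R -> R) :
  (forall t, 0 <= t -> 0 <= V t) -> (forall s t, 0 <= s -> s <= t -> V t <= V s) ->
  forall e, e > 0 -> exists T, 0 <= T /\ forall s t, T <= s -> s <= t -> V s - V t < e.
Proof.
  intros Hpos Hmono e He.
  set (E := fun y => exists t, 0 <= t /\ y = - V t).
  destruct (completeness E) as [c [Hub Hlub]].
  - exists 0; intros y [t [Ht ->]]; specialize (Hpos t Ht); lra.
  - exists (- V 0), 0; split; [lra|reflexivity].
  - assert (Hnear : exists T, 0 <= T /\ V T < - c + e).
    { apply NNPP; intros Hno. assert (c <= c - e); [|lra].
      apply Hlub; intros y [t [Ht ->]]; apply Rnot_lt_le; intros Hlt; apply Hno.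
      exists t; split; [exact Ht|lra]. }
    destruct Hnear as [T [HT HVT]]; exists T; split; [exact HT|]; intros s t Hs Hst.
    pose proof (Hmono T s HT Hs).
    assert (- V t <= c) by (apply Hub; exists t; split; [lra|reflexivity]); lra.
Qed.

(** * Euclidean geometry *)

(** Distances are kept squared so that all estimates stay polynomial; roots appear only where
    [vnorm] is unfolded. *)
Definition dist2 (m : nat) (u v : vec) : R := dot m (vsub u v) (vsub u v).

Lemma dot_sym (m : nat) (u v : vec) : dot m u v = dot m v u.
Proof. apply rsum_ext; intros; ring. Qed.

Lemma dot_nonneg (m : nat) (u : vec) : 0 <= dot m u u.
Proof. apply rsum_nonneg; intros; nra. Qed.

Lemma dot_plus_r (m : nat) (u v w : vec) : dot m u (fun k => v k + w k) = dot m u v + dot m u w.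
Proof. unfold dot; rewrite <- rsum_plus; apply rsum_ext; intros; ring. Qed.

Lemma dot_scal_r (m : nat) (c : R) (u v : vec) : dot m u (fun k => c * v k) = c * dot m u v.
Proof. unfold dot; rewrite <- rsum_scal; apply rsum_ext; intros; ring. Qed.

Lemma dot_sub_r (m : nat) (u v w : vec) : dot m u (vsub v w) = dot m u v - dot m u w.
Proof. unfold dot, vsub; rewrite <- rsum_minus; apply rsum_ext; intros; ring. Qed.

Lemma dot_rsum_r (m n : nat) (u : vec) (c : nat -> R) (v : nat -> vec) :
  dot m u (fun k => rsum n (fun j => c j * v j k)) = rsum n (fun j => c j * dot m u (v j)).
Proof.
  unfold dot.
  rewrite (rsum_ext m _ (fun k => rsum n (fun j => c j * (u k * v j k)))).
  - rewrite rsum_swap; apply rsum_ext; intros; now rewrite rsum_scal.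
  - intros k _; rewrite <- rsum_scal; apply rsum_ext; intros; ring.
Qed.

Lemma dist2_nonneg (m : nat) (u v : vec) : 0 <= dist2 m u v.
Proof. apply dot_nonneg. Qed.

Lemma dist2_sym (m : nat) (u v : vec) : dist2 m u v = dist2 m v u.
Proof. apply rsum_ext; intros; unfold vsub; ring. Qed.

Lemma dist2_refl (m : nat) (u : vec) : dist2 m u u = 0.
Proof. apply rsum_0; intros; unfold vsub; ring. Qed.

(** Coordinatewise [(a + b)^2 <= 2 a^2 + 2 b^2]. The factors 2 are the price of avoiding roots and
    account for the numerical constants further on. *)
Lemma dist2_triangle (m : nat) (u v w : vec) : dist2 m u w <= 2 * dist2 m u v + 2 * dist2 m v w.
Proof.
  unfold dist2, dot, vsub; rewrite <- !rsum_scal, <- rsum_plus; apply rsum_le; intros k _.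
  pose proof (Rle_0_sqr (u k - v k - (v k - w k))); unfold Rsqr in *; lra.
Qed.

Lemma dist2_expand (m : nat) (c : R) (u v : vec) :
  dist2 m u (fun k => c * v k) = dot m u u - 2 * c * dot m u v + c * c * dot m v v.
Proof.
  unfold dist2, dot, vsub; rewrite <- !rsum_scal, <- rsum_minus, <- rsum_plus.
  apply rsum_ext; intros; ring.
Qed.

Lemma cauchy_schwarz (m : nat) (u v : vec) :
  dot m u v * dot m u v <= dot m u u * dot m v v.
Proof.
  assert (Hq : forall c, 0 <= dot m u u - 2 * c * dot m u v + c * c * dot m v v).
  { intros c; rewrite <- dist2_expand; apply dist2_nonneg. }
  pose proof (dot_nonneg m u); pose proof (dot_nonneg m v).
  set (A := dot m u u) in *; set (B := dot m u v) in *; set (C := dot m v v) in *.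
  destruct (Req_dec C 0) as [HC|HC].
  - destruct (Req_dec B 0) as [->|HB]; [rewrite HC; lra|].
    (* With [C = 0] the quadratic is affine in [c]; this value of [c] would make it equal to -1. *)
    specialize (Hq ((A + 1) / (2 * B))); rewrite HC in Hq.
    replace (2 * ((A + 1) / (2 * B)) * B) with (A + 1) in Hq by (field; exact HB); lra.
  - specialize (Hq (B / C)).
    replace (A - 2 * (B / C) * B + B / C * (B / C) * C) with ((A * C - B * B) / C) in Hq
      by (field; exact HC).
    apply Rmult_le_compat_r with (r := C) in Hq; [|lra].
    replace ((A * C - B * B) / C * C) with (A * C - B * B) in Hq by (field; exact HC); lra.
Qed.

Lemma dot_sub_sqr_le (m : nat) (u v w : vec) :
  Rsqr (dot m u v - dot m u w) <= dot m u u * dist2 m v w.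
Proof. rewrite <- dot_sub_r; apply cauchy_schwarz. Qed.

(** Splits the pull of a neighbour [g] on [f] into a difference of squared distances to [q], which
    cancels in balanced sums, and the dissipation [- dist2 m g f]. *)
Lemma dot_polar (m : nat) (f g q : vec) :
  2 * dot m (vsub f q) (vsub g f) = dist2 m g q - dist2 m f q - dist2 m g f.
Proof.
  unfold dist2, dot, vsub; rewrite <- rsum_scal, <- !rsum_minus; apply rsum_ext; intros; ring.
Qed.

(** Replaces [dot_polar] when [g] belongs to another cluster, with its own anchor [r]. With [x],
    [y], [z] as in the proof, it is [(x - y)^2 + (x - z)^2 >= 0]. *)
Lemma dot_cross_le (m : nat) (f g q r : vec) :
  2 * dot m (vsub f q) (vsub g f) <= dist2 m g r + dist2 m r q.
Proof.
  unfold dist2, dot, vsub; rewrite <- rsum_scal, <- !rsum_plus; apply rsum_le; intros k _.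
  set (x := f k - q k); set (y := g k - r k); set (z := r k - q k).
  replace (g k - f k) with (y + z - x) by (unfold x, y, z; ring).
  pose proof (Rle_0_sqr (x - y)); pose proof (Rle_0_sqr (x - z)); unfold Rsqr in *; lra.
Qed.

(** * Error bounds for subsystems of linear equations *)

(** Only the values of [S] below [n] matter, so there are finitely many cases: fix the membership of
    the last index both ways and keep the larger constant. *)
Lemma uniform_over_subsets (n : nat) (P : (nat -> bool) -> R -> Prop) :
  (forall S S' c, (forall i, (i < n)%nat -> S i = S' i) -> P S c -> P S' c) ->
  (forall S c c', c <= c' -> P S c -> P S c') ->
  (forall S, exists c, P S c) -> exists c, forall S, P S c.
Proof.
  revert P; induction n as [|n IH]; intros P Hext Hmono Hex.
  - destruct (Hex (fun _ => true)) as [c Hc]; exists c; intros S.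
    apply (Hext (fun _ => true)); [lia|exact Hc].
  - set (upd := fun (S : nat -> bool) b i => if Nat.eqb i n then b else S i).
    assert (Hb : forall b, exists c, forall S, P (upd S b) c).
    { intros b; apply (IH (fun S => P (upd S b))).
      - intros S S' c HS; apply Hext; intros i Hi; unfold upd.
        destruct (Nat.eqb_spec i n); [reflexivity|apply HS; lia].
      - intros S; apply Hmono.
      - intros S; apply Hex. }
    destruct (Hb true) as [c1 H1]; destruct (Hb false) as [c2 H2].
    exists (Rmax c1 c2); intros S.
    apply (Hext (upd S (S n))).
    + intros i _; unfold upd; destruct (Nat.eqb_spec i n); [now subst i|reflexivity].
    + destruct (S n); [apply (Hmono _ c1); [apply Rmax_l|apply H1]
                      |apply (Hmono _ c2); [apply Rmax_r|apply H2]].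
Qed.

Definition residual2 (m n : nat) (h : nat -> vec) (S : nat -> bool) (v : vec) : R :=
  rsum n (fun k => if S k then Rsqr (dot m (h k) v) else 0).

Lemma residual2_nonneg (m n : nat) (h : nat -> vec) (S : nat -> bool) (v : vec) :
  0 <= residual2 m n h S v.
Proof. apply rsum_nonneg; intros k _; destruct (S k); [apply Rle_0_sqr|lra]. Qed.

(* Hoffman's error bound for homogeneous linear equations. *)
Lemma kernel_error_bound (m n : nat) (h : nat -> vec) (S : nat -> bool) :
  exists c, 0 <= c /\ forall v, exists u,
    (forall k, (k < n)%nat -> S k = true -> dot m (h k) u = 0) /\
    dist2 m v u <= c * residual2 m n h S v.
Proof.
  induction n as [|n [c [Hc IH]]].
  - exists 0; split; [lra|]; intros v; exists v; split; [lia|rewrite dist2_refl; lra].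
  - destruct (S n) eqn:HSn.
    (* Either some [e] solves the earlier equations but not the new one, and the approximate
       solution is corrected along [e]; or the earlier equations imply the new one and nothing
       changes. *)
    + destruct (classic (exists e, (forall k, (k < n)%nat -> S k = true -> dot m (h k) e = 0)
                                   /\ dot m (h n) e <> 0)) as [[e [He Hne]]|Hno].
      * set (r := dot m (h n) e) in *.
        set (H2 := dot m (h n) (h n)); set (E2 := dot m e e / (r * r)).
        assert (HH2 : 0 <= H2) by apply dot_nonneg.
        assert (HE2 : 0 <= E2).
        { apply Rmult_le_pos; [apply dot_nonneg|apply Rlt_le, Rinv_0_lt_compat].
          pose proof (Rsqr_pos_lt r Hne); unfold Rsqr in *; lra. }
        (* The correction has squared length [E2 * (a * a)] with
           [a * a <= 2 * (b * b) + 2 * H2 * c * Rv]; [dist2_triangle] doubles both contributions. *)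
        exists (2 * c + 4 * E2 * H2 * c + 4 * E2); split.
        { assert (0 <= E2 * H2) by now apply Rmult_le_pos.
          assert (0 <= E2 * H2 * c) by now apply Rmult_le_pos.
          lra. }
        intros v; destruct (IH v) as [u [Hu Hvu]].
        set (a := dot m (h n) u).
        exists (vsub u (fun k => a / r * e k)); split.
        -- intros k Hk HS; rewrite dot_sub_r, dot_scal_r.
           destruct (Nat.eq_dec k n) as [->|Hkn].
           ++ fold a r; field; exact Hne.
           ++ rewrite Hu, He by (lia || assumption); ring.
        -- unfold residual2; simpl; rewrite HSn; fold (residual2 m n h S v).
           pose proof (residual2_nonneg m n h S v) as HR; set (Rv := residual2 m n h S v) in *.
           pose proof (dot_sub_sqr_le m (h n) v u) as Hcs; fold H2 a in Hcs.
           set (b := dot m (h n) v) in *.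
           assert (Ha : a * a <= 2 * (b * b) + 2 * (H2 * (c * Rv))).
           { assert (H2 * dist2 m v u <= H2 * (c * Rv)) by now apply Rmult_le_compat_l.
             pose proof (Rle_0_sqr (a - 2 * b)); unfold Rsqr in *; lra. }
           assert (Hd : dist2 m u (vsub u (fun k => a / r * e k)) = E2 * (a * a)).
           { unfold dist2, E2. transitivity (dot m (fun k => a / r * e k) (fun k => a / r * e k)).
             - apply rsum_ext; intros; unfold vsub; ring.
             - rewrite dot_scal_r, dot_sym, dot_scal_r; field; exact Hne. }
           eapply Rle_trans; [apply (dist2_triangle m v u)|].
           rewrite Hd.
           assert (E2 * (a * a) <= E2 * (2 * (b * b) + 2 * (H2 * (c * Rv))))
             by now apply Rmult_le_compat_l.
           assert (0 <= E2 * H2) by now apply Rmult_le_pos.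
           assert (0 <= E2 * H2 * c) by now apply Rmult_le_pos.
           assert (0 <= E2 * H2 * c * (b * b)) by (apply Rmult_le_pos; nra).
           assert (0 <= c * (b * b)) by (apply Rmult_le_pos; nra).
           assert (0 <= E2 * Rv) by now apply Rmult_le_pos.
           unfold Rsqr; nra.
      * exists c; split; [exact Hc|]; intros v; destruct (IH v) as [u [Hu Hvu]].
        exists u; split.
        -- intros k Hk HS; destruct (Nat.eq_dec k n) as [->|Hkn]; [|apply Hu; [lia|exact HS]].
           apply NNPP; intros Hne; apply Hno; now exists u.
        -- eapply Rle_trans; [exact Hvu|apply Rmult_le_compat_l; [exact Hc|]].
           unfold residual2; simpl; rewrite HSn; pose proof (Rle_0_sqr (dot m (h n) v)); lra.
    + exists c; split; [exact Hc|]; intros v; destruct (IH v) as [u [Hu Hvu]].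
      exists u; split.
      * intros k Hk HS; destruct (Nat.eq_dec k n) as [->|Hkn]; [congruence|].
        apply Hu; [lia|exact HS].
      * unfold residual2; simpl; rewrite HSn, Rplus_0_r; exact Hvu.
Qed.

(** Clusters change in the course of the argument, so the constant has to be the same for every
    subset of equations. *)
Lemma kernel_error_bound_uniform (m n : nat) (h : nat -> vec) :
  exists c, forall S v, exists u,
    (forall k, (k < n)%nat -> S k = true -> dot m (h k) u = 0) /\
    dist2 m v u <= c * residual2 m n h S v.
Proof.
  apply (uniform_over_subsets n (fun S c => forall v, exists u,
    (forall k, (k < n)%nat -> S k = true -> dot m (h k) u = 0) /\
    dist2 m v u <= c * residual2 m n h S v)).
  - intros S S' c HS H v; destruct (H v) as [u [Hu Hd]]; exists u; split.
    + intros k Hk HS'; apply Hu; [exact Hk|now rewrite HS].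
    + replace (residual2 m n h S' v) with (residual2 m n h S v); [exact Hd|].
      apply rsum_ext; intros k Hk; now rewrite HS.
  - intros S c c' Hc H v; destruct (H v) as [u [Hu Hd]]; exists u; split; [exact Hu|].
    eapply Rle_trans; [exact Hd|apply Rmult_le_compat_r; [apply residual2_nonneg|exact Hc]].
  - intros S; destruct (kernel_error_bound m n h S) as [c [_ Hc]]; now exists c.
Qed.

(** * Weight-balanced flows *)

Section BalancedFlow.

(** The abstract system behind both flows: [alpha i j] will be [K] times the weight of the arc from
    [j] to [i] (with [K = 1] for projection consensus), [w] is constant or a left null vector of the
    Laplacian, and [P] holds at the times where the differential equation does. *)
Context (N m : nat) (h : nat -> vec) (z : nat -> R) (x : nat -> R -> vec)
  (alpha : nat -> nat -> R -> R) (w : nat -> R) (amax delta : R) (P : R -> Prop).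

Definition resid (i : nat) (t : R) : R := dot m (h i) (x i t) - z i.

Hypothesis h_unit : forall i, (i < N)%nat -> dot m (h i) (h i) = 1.
Hypothesis w_pos : forall i, (i < N)%nat -> 0 < w i.
Hypothesis w_sum : rsum N w = 1.
Hypothesis alpha_bound : forall i j t, (i < N)%nat -> (j < N)%nat -> 0 <= t ->
  0 <= alpha i j t <= amax.
Hypothesis alpha_balanced : forall i t, (i < N)%nat -> 0 <= t ->
  rsum N (fun j => w i * alpha i j t) = rsum N (fun j => w j * alpha j i t).
Hypothesis x_ac : forall i k, (i < N)%nat -> (k < m)%nat -> loc_ac (fun t => x i t k).
Hypothesis P_ae : ae_pos P.
Hypothesis dist2_deriv : forall t i q, 0 < t -> P t -> (i < N)%nat -> inAi m h z i q ->
  derivable_pt_lim (fun s => dist2 m (x i s) q) t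
    (rsum N (fun j => alpha i j t * (2 * dot m (vsub (x i t) q) (vsub (x j t) (x i t))))
     - 2 * Rsqr (resid i t)).
Hypothesis kernel_deriv : forall t i v, 0 < t -> P t -> (i < N)%nat ->
  (forall k, (k < N)%nat -> dot m (h k) v = 0) ->
  derivable_pt_lim (fun s => dot m v (x i s)) t
    (rsum N (fun j => alpha i j t * (dot m v (x j t) - dot m v (x i t)))).
Hypothesis resid_deriv : forall t i, 0 < t -> P t -> (i < N)%nat ->
  exists d, derivable_pt_lim (resid i) t d /\
    Rabs d <= rsum N (fun j => alpha i j t * Rabs (dot m (h i) (vsub (x j t) (x i t))))
              + Rabs (resid i t).
Hypothesis delta_pos : delta > 0.
Hypothesis jointly_connected : forall s (cl : nat -> nat) i0 j0, 0 <= s ->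
  (i0 < N)%nat -> (j0 < N)%nat -> cl i0 <> cl j0 ->
  exists i j T I, (i < N)%nat /\ (j < N)%nat /\ cl i <> cl j /\ s <= T /\
    HK_integral (alpha i j) s T I /\ I >= delta.

(** The reference point may depend on the agent: a constant [q] gives the energy [V], and one anchor
    per cluster gives [W]. *)
Definition wdist2 (q : nat -> vec) (t : R) : R :=
  rsum N (fun i => w i * dist2 m (x i t) (q i)).

Lemma loc_ac_dist2 (i : nat) (q : vec) :
  (i < N)%nat -> loc_ac (fun t => dist2 m (x i t) q).
Proof.
  intros Hi; apply (loc_ac_rsum m (fun k t => vsub (x i t) q k * vsub (x i t) q k)).
  intros k Hk; apply (loc_ac_sqr (fun t => vsub (x i t) q k)).
  unfold vsub; apply loc_ac_plus; [now apply x_ac|apply loc_ac_const].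
Qed.

Lemma loc_ac_dist2_pair (i j : nat) :
  (i < N)%nat -> (j < N)%nat -> loc_ac (fun t => dist2 m (x i t) (x j t)).
Proof.
  intros Hi Hj.
  apply (loc_ac_rsum m (fun k t => vsub (x i t) (x j t) k * vsub (x i t) (x j t) k)).
  intros k Hk; apply (loc_ac_sqr (fun t => vsub (x i t) (x j t) k)).
  apply (loc_ac_le (fun t => x i t k + -1 * x j t k) _ 1).
  - apply loc_ac_plus; [now apply x_ac|now apply loc_ac_scal, x_ac].
  - intros T _ u v _ _; rewrite Rmult_1_l; apply Req_le; f_equal; unfold vsub; ring.
Qed.

Lemma loc_ac_dot (v : vec) (i : nat) : (i < N)%nat -> loc_ac (fun t => dot m v (x i t)).
Proof.
  intros Hi; apply (loc_ac_rsum m (fun k t => v k * x i t k)); intros k Hk.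
  now apply loc_ac_scal, x_ac.
Qed.

Lemma loc_ac_wdist2 (q : nat -> vec) : loc_ac (wdist2 q).
Proof.
  apply (loc_ac_rsum N (fun i t => w i * dist2 m (x i t) (q i))); intros i Hi.
  now apply loc_ac_scal, loc_ac_dist2.
Qed.

(** After exchanging the sums, the coefficient of each [d i] is a difference of the two sides of the
    balance condition. *)
Lemma balanced_difference_sum (d : nat -> R) (t : R) : 0 <= t ->
  rsum N (fun i => rsum N (fun j => w i * alpha i j t * (d j - d i))) = 0.
Proof.
  intros Ht.
  rewrite (rsum_ext N _ (fun i => rsum N (fun j => d j * (w i * alpha i j t))
                                  - d i * rsum N (fun j => w i * alpha i j t))).
  - rewrite rsum_minus, rsum_swap, <- rsum_minus; apply rsum_0; intros i Hi.
    rewrite rsum_scal, alpha_balanced by assumption; ring.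
  - intros i _; rewrite <- rsum_scal, <- rsum_minus; apply rsum_ext; intros; ring.
Qed.

(** Differences of squared distances cancel by balance, and only the excess [c i j] survives: minus
    the dissipation when all anchors agree, a bounded cost across clusters for [W]. *)
Lemma wdist2_rate (q : nat -> vec) (c : nat -> nat -> R) (t : R) :
  0 < t -> P t -> (forall i, (i < N)%nat -> inAi m h z i (q i)) ->
  (forall i j, (i < N)%nat -> (j < N)%nat ->
     2 * dot m (vsub (x i t) (q i)) (vsub (x j t) (x i t))
     <= dist2 m (x j t) (q j) - dist2 m (x i t) (q i) + c i j) ->
  exists d, derivable_pt_lim (wdist2 q) t d /\
    d <= rsum N (fun i => rsum N (fun j => w i * alpha i j t * c i j))
         - 2 * rsum N (fun i => w i * Rsqr (resid i t)).
Proof.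
  intros Ht HPt Hq Hc.
  exists (rsum N (fun i => w i *
     (rsum N (fun j => alpha i j t * (2 * dot m (vsub (x i t) (q i)) (vsub (x j t) (x i t))))
      - 2 * Rsqr (resid i t)))).
  split.
  - apply (derivable_pt_lim_rsum N (fun i s => w i * dist2 m (x i s) (q i))); intros i Hi.
    apply derivable_pt_lim_scal, dist2_deriv; auto.
  - rewrite <- (Rplus_0_l (rsum N (fun i => rsum N (fun j => w i * alpha i j t * c i j)))).
    rewrite <- (balanced_difference_sum (fun i => dist2 m (x i t) (q i)) t) by lra.
    rewrite <- rsum_plus, <- rsum_scal, <- rsum_minus; apply rsum_le; intros i Hi.
    rewrite Rmult_minus_distr_l, <- rsum_scal, <- rsum_plus.
    apply Rplus_le_compat; [|right; ring].
    apply rsum_le; intros j Hj.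
    rewrite <- Rmult_plus_distr_l, <- Rmult_assoc.
    apply Rmult_le_compat_l; [|now apply Hc].
    apply Rmult_le_pos; [apply Rlt_le; auto|apply alpha_bound; auto; lra].
Qed.

Lemma weight_lower_bound : exists w0, w0 > 0 /\ forall i, (i < N)%nat -> w0 <= w i.
Proof.
  apply (uniform_radius N (fun i d => d <= w i)).
  - intros; lra.
  - intros i Hi; exists (w i); split; [now apply w_pos|lra].
Qed.

Lemma wdist2_nonneg (q : nat -> vec) (t : R) : 0 <= wdist2 q t.
Proof.
  apply rsum_nonneg; intros i Hi; apply Rmult_le_pos; [apply Rlt_le; auto|apply dist2_nonneg].
Qed.

Lemma dist2_le_wdist2 (w0 : R) (q : nat -> vec) (i : nat) (t : R) :
  w0 > 0 -> (forall k, (k < N)%nat -> w0 <= w k) -> (i < N)%nat ->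
  dist2 m (x i t) (q i) <= wdist2 q t / w0.
Proof.
  intros Hw0 Hw Hi.
  assert (H : w i * dist2 m (x i t) (q i) <= wdist2 q t).
  { apply (rsum_term_le N (fun i => w i * dist2 m (x i t) (q i))); [|exact Hi].
    intros k Hk; apply Rmult_le_pos; [apply Rlt_le; auto|apply dist2_nonneg]. }
  assert (H' : w0 * dist2 m (x i t) (q i) <= wdist2 q t).
  { eapply Rle_trans; [|exact H].
    apply Rmult_le_compat_r; [apply dist2_nonneg|now apply Hw]. }
  apply Rmult_le_reg_l with w0; [exact Hw0|].
  replace (w0 * (wdist2 q t / w0)) with (wdist2 q t) by (field; lra); exact H'.
Qed.

Lemma wdist2_le (q : nat -> vec) (t r : R) :
  (forall i, (i < N)%nat -> dist2 m (x i t) (q i) <= r) -> wdist2 q t <= r.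
Proof.
  intros H; rewrite <- (Rmult_1_r r), <- w_sum, <- rsum_scal; apply rsum_le; intros i Hi.
  rewrite (Rmult_comm r); apply Rmult_le_compat_l; [apply Rlt_le; auto|auto].
Qed.

(** * Energy around a common solution *)

Section AroundSolution.

Context (y : vec).
Hypothesis y_sol : inA N m h z y.

Let V := wdist2 (fun _ => y).

Lemma energy_rate (t : R) : 0 < t -> P t ->
  exists d, derivable_pt_lim V t d /\
    d <= rsum N (fun i => rsum N (fun j => w i * alpha i j t * - dist2 m (x j t) (x i t)))
         - 2 * rsum N (fun i => w i * Rsqr (resid i t)).
Proof.
  intros Ht HPt; apply wdist2_rate; auto.
  intros i j _ _; rewrite dot_polar; lra.
Qed.

Lemma wresid_nonneg (t : R) : 0 <= rsum N (fun i => w i * Rsqr (resid i t)).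
Proof.
  apply rsum_nonneg; intros i Hi; apply Rmult_le_pos; [apply Rlt_le; auto|apply Rle_0_sqr].
Qed.

Lemma pair_dissipation_nonneg (i j : nat) (t : R) : 0 <= t -> (i < N)%nat -> (j < N)%nat ->
  0 <= w i * alpha i j t * dist2 m (x j t) (x i t).
Proof.
  intros Ht Hi Hj; repeat apply Rmult_le_pos; [apply Rlt_le; auto| |apply dist2_nonneg].
  now apply alpha_bound.
Qed.

Lemma energy_rate_neg (t : R) : 0 <= t ->
  rsum N (fun i => rsum N (fun j => w i * alpha i j t * - dist2 m (x j t) (x i t))) <= 0.
Proof.
  intros Ht; rewrite <- (rsum_0 N (fun _ => 0)) by auto; apply rsum_le; intros i Hi.
  rewrite <- (rsum_0 N (fun _ => 0)) by auto; apply rsum_le; intros j Hj.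
  pose proof (pair_dissipation_nonneg i j t Ht Hi Hj); lra.
Qed.

Lemma energy_nonincreasing (s t : R) : 0 <= s -> s <= t -> V t <= V s.
Proof.
  intros Hs Hst.
  assert (V t - V s <= 0 * (t - s)); [|lra].
  apply (ac_increment_le_const V P); auto; [apply loc_ac_wdist2|].
  intros u Hu HPu; destruct (energy_rate u ltac:(lra) HPu) as [d [Hd Hle]].
  exists d; split; [exact Hd|].
  pose proof (wresid_nonneg u); pose proof (energy_rate_neg u ltac:(lra)); lra.
Qed.

Lemma energy_cauchy (e : R) : e > 0 ->
  exists T, 0 <= T /\ forall s t, T <= s -> s <= t -> V s - V t < e.
Proof.
  apply nonincreasing_cauchy; [intros; apply wdist2_nonneg|exact energy_nonincreasing].
Qed.

Lemma state_bounded :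
  exists r, 0 <= r /\ forall i t, (i < N)%nat -> 0 <= t -> dist2 m (x i t) y <= r.
Proof.
  destruct weight_lower_bound as [w0 [Hw0 Hw]].
  exists (V 0 / w0); split.
  - apply Rmult_le_pos; [apply wdist2_nonneg|apply Rlt_le, Rinv_0_lt_compat; lra].
  - intros i t Hi Ht.
    eapply Rle_trans; [apply (dist2_le_wdist2 w0 (fun _ => y) i t Hw0 Hw Hi)|].
    apply Rmult_le_compat_r; [apply Rlt_le, Rinv_0_lt_compat; lra|].
    apply energy_nonincreasing; lra.
Qed.

(** Turns bounds on squares into crude bounds on absolute values without a root. *)
Lemma Rabs_le_1_sqr (u : R) : Rabs u <= 1 + Rsqr u.
Proof.
  pose proof (Rle_0_sqr (Rabs u - 1)) as H; rewrite (Rsqr_abs u); unfold Rsqr in *.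
  pose proof (Rabs_pos u); nra.
Qed.

(** Bounded energy bounds the states, hence the residuals and their derivatives. Only the rate of
    decrease is controlled, which is what the next lemma needs. *)
Lemma resid_sqr_lipschitz :
  exists L, L > 0 /\ forall i s t, (i < N)%nat -> 0 <= s -> s <= t ->
    Rsqr (resid i s) - Rsqr (resid i t) <= L * (t - s).
Proof.
  destruct state_bounded as [r [Hr Hb]].
  assert (Hres : forall i t, (i < N)%nat -> 0 <= t -> Rabs (resid i t) <= 1 + r).
  { intros i t Hi Ht; eapply Rle_trans; [apply Rabs_le_1_sqr|].
    apply Rplus_le_compat_l; unfold resid; rewrite <- (y_sol i Hi).
    eapply Rle_trans; [apply dot_sub_sqr_le|].
    rewrite h_unit, Rmult_1_l by assumption; now apply Hb. }
  assert (Hdiff : forall i j t, (i < N)%nat -> (j < N)%nat -> 0 <= t ->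
            Rabs (dot m (h i) (vsub (x j t) (x i t))) <= 1 + 4 * r).
  { intros i j t Hi Hj Ht; eapply Rle_trans; [apply Rabs_le_1_sqr|].
    apply Rplus_le_compat_l; rewrite dot_sub_r.
    eapply Rle_trans; [apply dot_sub_sqr_le|].
    rewrite h_unit, Rmult_1_l by assumption.
    eapply Rle_trans; [apply (dist2_triangle m _ y)|].
    rewrite (dist2_sym m y); pose proof (Hb i t Hi Ht); pose proof (Hb j t Hj Ht); lra. }
  set (K := INR N * (Rabs amax * (1 + 4 * r)) + (1 + r)).
  assert (HK : 0 < K).
  { unfold K; assert (0 <= INR N * (Rabs amax * (1 + 4 * r))); [|lra].
    apply Rmult_le_pos; [apply pos_INR|apply Rmult_le_pos; [apply Rabs_pos|lra]]. }
  exists (2 * ((1 + r) * K)); split.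
  { assert (0 < (1 + r) * K) by (apply Rmult_lt_0_compat; lra); lra. }
  intros i s t Hi Hs Hst.
  assert (H : -1 * (resid i t * resid i t) - -1 * (resid i s * resid i s)
              <= 2 * ((1 + r) * K) * (t - s)); [|unfold Rsqr; lra].
  apply (ac_increment_le_const (fun u => -1 * (resid i u * resid i u)) P); auto.
  - apply loc_ac_scal, loc_ac_sqr; unfold resid, Rminus.
    apply loc_ac_plus; [now apply loc_ac_dot|apply loc_ac_const].
  - intros u Hu HPu; destruct (resid_deriv u i ltac:(lra) HPu Hi) as [d [Hd Hle]].
    exists (-1 * (d * resid i u + resid i u * d)); split.
    + apply (derivable_pt_lim_scal (fun v => resid i v * resid i v)).
      now apply (derivable_pt_lim_mult (resid i) (resid i)).
    + pose proof (Hres i u Hi ltac:(lra)) as Hru.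
      assert (Hd' : Rabs d <= K).
      { eapply Rle_trans; [exact Hle|]; apply Rplus_le_compat; [|exact Hru].
        rewrite <- rsum_const; apply rsum_le; intros j Hj.
        destruct (alpha_bound i j u Hi Hj ltac:(lra)) as [Ha1 Ha2].
        apply Rmult_le_compat; [exact Ha1|apply Rabs_pos| |apply Hdiff; auto; lra].
        pose proof (Rle_abs amax); lra. }
      assert (Rabs (resid i u * d) <= (1 + r) * K).
      { rewrite Rabs_mult; apply Rmult_le_compat; auto; apply Rabs_pos. }
      pose proof (Rle_abs (- (resid i u * d))) as Ha; rewrite Rabs_Ropp in Ha; lra.
Qed.

(** A Barbalat argument: a squared residual above [e] stays above [e / 2] for a time
    [tau = e / (2 * L)], during which the energy drops by at least [w i * e * tau]. At late times
    this exceeds the remaining budget. *)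
Lemma resid_vanishes (e : R) : e > 0 ->
  exists T, forall t, t >= T -> forall i, (i < N)%nat -> Rsqr (resid i t) <= e.
Proof.
  intros He; apply (uniform_time N (fun i t => Rsqr (resid i t) <= e)); intros i Hi.
  destruct resid_sqr_lipschitz as [L [HL HLip]].
  pose proof (w_pos i Hi) as Hwi.
  set (tau := e / (2 * L)).
  assert (Htau : 0 < tau) by (apply Rdiv_lt_0_compat; lra).
  destruct (energy_cauchy (w i * e * tau)) as [T [HT0 HT]].
  { apply Rmult_lt_0_compat; [apply Rmult_lt_0_compat|]; assumption. }
  exists T; intros t Ht; apply Rnot_lt_le; intros Hlt.
  assert (Hdrop : V (t + tau) - V t <= - (w i * e) * (t + tau - t)).
  { apply (ac_increment_le_const V P); auto; try lra; [apply loc_ac_wdist2|].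
    intros u Hu HPu; destruct (energy_rate u ltac:(lra) HPu) as [d [Hd Hle]].
    exists d; split; [exact Hd|].
    pose proof (energy_rate_neg u ltac:(lra)).
    assert (Hsum : w i * Rsqr (resid i u) <= rsum N (fun i => w i * Rsqr (resid i u))).
    { apply (rsum_term_le N (fun i => w i * Rsqr (resid i u))); [|exact Hi].
      intros k Hk; apply Rmult_le_pos; [apply Rlt_le; auto|apply Rle_0_sqr]. }
    assert (Hlow : e / 2 <= Rsqr (resid i u)).
    { pose proof (HLip i t u Hi ltac:(lra) ltac:(lra)).
      assert (L * (u - t) <= L * tau) by (apply Rmult_le_compat_l; lra).
      replace (L * tau) with (e / 2) in * by (unfold tau; field; lra); lra. }
    assert (w i * (e / 2) <= w i * Rsqr (resid i u)) by (apply Rmult_le_compat_l; lra).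
    lra. }
  specialize (HT t (t + tau) ltac:(lra) ltac:(lra)).
  replace (t + tau - t) with tau in Hdrop by ring; lra.
Qed.

(** * Clusters and their merging *)

Definition tight (e : R) (cl : nat -> nat) (t : R) : Prop :=
  forall i j, (i < N)%nat -> (j < N)%nat -> cl i = cl j -> dist2 m (x i t) (x j t) <= e.

(** A representative [i0] nearly satisfies the equation of every member [k], since [x k] does and is
    close to [x i0]. The error bound moves [x i0 - y] to an exact solution [u] of the homogeneous
    equations of the cluster, and [y + u] is the anchor. *)
Lemma cluster_solution :
  exists c, 0 <= c /\ forall cl e b t, 0 <= e -> 0 <= b -> tight e cl t ->
    (forall i, (i < N)%nat -> Rsqr (resid i t) <= b) ->
    exists q : nat -> vec, forall i, (i < N)%nat ->
      inAi m h z i (q (cl i)) /\ dist2 m (x i t) (q (cl i)) <= c * (e + b).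
Proof.
  destruct (kernel_error_bound_uniform m N h) as [c0 Hc0].
  set (c1 := Rabs c0 * INR N).
  assert (Hc1 : 0 <= c1) by (apply Rmult_le_pos; [apply Rabs_pos|apply pos_INR]).
  (* From [2 * e + 2 * (c1 * (2 * e + 2 * b))]: member to representative, then representative to
     anchor. *)
  exists (2 + 4 * c1); split; [lra|]; intros cl e b t He Hb Hti Hres.
  destruct (functional_choice (fun l (q : vec) => forall i, (i < N)%nat -> cl i = l ->
           inAi m h z i q /\ dist2 m (x i t) q <= (2 + 4 * c1) * (e + b))) as [q Hq].
  { intros l; destruct (classic (exists i0, (i0 < N)%nat /\ cl i0 = l)) as [[i0 [Hi0 Hl]]|Hno].
    - destruct (Hc0 (fun k => Nat.eqb (cl k) l) (vsub (x i0 t) y)) as [u [Hu Hd]].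
      exists (fun k => y k + u k).
      assert (Hd0 : dist2 m (x i0 t) (fun k => y k + u k) <= c1 * (2 * e + 2 * b)).
      { replace (dist2 m (x i0 t) (fun k => y k + u k)) with (dist2 m (vsub (x i0 t) y) u)
          by (apply rsum_ext; intros; unfold vsub; ring).
        eapply Rle_trans; [exact Hd|].
        apply Rle_trans with (Rabs c0 * residual2 m N h (fun k => Nat.eqb (cl k) l)
                                (vsub (x i0 t) y)).
        { apply Rmult_le_compat_r; [apply residual2_nonneg|apply Rle_abs]. }
        unfold c1; rewrite Rmult_assoc; apply Rmult_le_compat_l; [apply Rabs_pos|].
        rewrite <- rsum_const; apply rsum_le; intros k Hk.
        destruct (Nat.eqb_spec (cl k) l) as [Hkl|_]; [|lra].
        rewrite dot_sub_r, (y_sol k Hk).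
        set (a1 := dot m (h k) (x i0 t) - dot m (h k) (x k t)).
        replace (dot m (h k) (x i0 t) - z k) with (a1 + resid k t) by (unfold a1, resid; ring).
        assert (Ha1 : Rsqr a1 <= e).
        { eapply Rle_trans; [apply dot_sub_sqr_le|].
          rewrite h_unit, Rmult_1_l by assumption; apply Hti; congruence. }
        pose proof (Hres k Hk); pose proof (Rle_0_sqr (a1 - resid k t)); unfold Rsqr in *; lra. }
      intros i Hi Hil; split.
      + unfold inAi; rewrite dot_plus_r, (y_sol i Hi), Hu; [ring|exact Hi|].
        now apply Nat.eqb_eq.
      + eapply Rle_trans; [apply (dist2_triangle m _ (x i0 t))|].
        assert (dist2 m (x i t) (x i0 t) <= e) by (apply Hti; congruence).
        assert (0 <= c1 * e) by now apply Rmult_le_pos.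
        assert (0 <= c1 * b) by now apply Rmult_le_pos.
        lra.
    - exists y; intros i Hi Hil; exfalso; apply Hno; now exists i. }
  exists q; intros i Hi; now apply Hq.
Qed.

(** Continuity of finitely many pairwise distances; it supplies the openness that [first_time]
    requires. *)
Lemma separation_persists (cl : nat -> nat) (th T t : R) :
  0 <= t <= T ->
  (forall i j, (i < N)%nat -> (j < N)%nat -> cl i <> cl j -> th < dist2 m (x i t) (x j t)) ->
  exists d, d > 0 /\ forall i j u, (i < N)%nat -> (j < N)%nat -> cl i <> cl j ->
    0 <= u <= T -> Rabs (u - t) < d -> th < dist2 m (x i u) (x j u).
Proof.
  intros Ht H.
  destruct (uniform_radius N (fun i d => forall j, (j < N)%nat -> cl i <> cl j -> forall u,
     0 <= u <= T -> Rabs (u - t) < d -> th < dist2 m (x i u) (x j u))) as [d [Hd Hall]].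
  - intros i d d' Hd H1 j Hj Hij u Hu Hut; apply H1; auto; lra.
  - intros i Hi.
    apply (uniform_radius N (fun j d => cl i <> cl j -> forall u,
      0 <= u <= T -> Rabs (u - t) < d -> th < dist2 m (x i u) (x j u))) .
    + intros j d d' Hd H1 Hij u Hu Hut; apply H1; auto; lra.
    + intros j Hj; destruct (Nat.eq_dec (cl i) (cl j)) as [He|Hne].
      * exists 1; split; [lra|tauto].
      * specialize (H i j Hi Hj Hne).
        destruct (loc_ac_unif_cont _ T (dist2 m (x i t) (x j t) - th)
                    (loc_ac_dist2_pair i j Hi Hj) ltac:(lra) ltac:(lra)) as [d [Hd Hc]].
        exists d; split; [exact Hd|]; intros _ u Hu Hut.
        specialize (Hc t u Ht Hu Hut); apply Rabs_def2 in Hc; lra.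
  - exists d; split; [exact Hd|]; intros; now apply Hall.
Qed.

(** If distinct clusters stayed more than [th] apart, the dissipation along one crossing arc of
    integrated weight at least [delta] would alone consume the energy budget [th * w0 * delta]. *)
Lemma clusters_meet (w0 th s : R) (cl : nat -> nat) (i0 j0 : nat) :
  w0 > 0 -> (forall i, (i < N)%nat -> w0 <= w i) -> th > 0 -> 0 <= s ->
  (forall t, s <= t -> V s - V t < th * w0 * delta) ->
  (i0 < N)%nat -> (j0 < N)%nat -> cl i0 <> cl j0 ->
  exists t, s <= t /\ exists i j, (i < N)%nat /\ (j < N)%nat /\ cl i <> cl j /\
    dist2 m (x i t) (x j t) <= th.
Proof.
  intros Hw0 Hw Hth Hs HV Hi0 Hj0 Hne; apply NNPP; intros Hno.
  destruct (jointly_connected s cl i0 j0 Hs Hi0 Hj0 Hne)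
    as (i & j & T & I & Hi & Hj & Hij & HsT & HI & Hdel).
  assert (Hdrop : V T - V s <= - (th * w i) * I).
  { apply (ac_increment_le V (fun u => - (th * w i) * alpha i j u) P T s T _
             (Rabs (th * w i) * amax)); auto; try lra.
    - apply loc_ac_wdist2; lra.
    - intros u Hu HPu; destruct (energy_rate u ltac:(lra) HPu) as [d [Hd Hle]].
      exists d; split; [exact Hd|].
      pose proof (wresid_nonneg u).
      assert (Hfar : th < dist2 m (x j u) (x i u)).
      { rewrite dist2_sym; apply Rnot_le_lt; intros Hc; apply Hno.
        exists u; split; [lra|]; now exists i, j. }
      assert (H1 : rsum N (fun i => rsum N (fun j => w i * alpha i j u * - dist2 m (x j u) (x i u)))
                   <= - (w i * alpha i j u * dist2 m (x j u) (x i u))).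
      { apply Ropp_le_cancel; rewrite Ropp_involutive.
        set (D := fun i j => w i * alpha i j u * dist2 m (x j u) (x i u)).
        replace (- rsum N (fun i => rsum N (fun j => w i * alpha i j u * - dist2 m (x j u) (x i u))))
          with (rsum N (fun i => rsum N (D i))).
        - apply Rle_trans with (rsum N (D i)).
          + apply (rsum_term_le N (D i)); [|exact Hj].
            intros; apply pair_dissipation_nonneg; auto; lra.
          + apply (rsum_term_le N (fun i => rsum N (D i))); [|exact Hi].
            intros; apply rsum_nonneg; intros; apply pair_dissipation_nonneg; auto; lra.
        - replace (- rsum N (fun i => rsum N (fun j => w i * alpha i j u * - dist2 m (x j u) (x i u))))
            with (-1 * rsum N (fun i => rsum N (fun j => w i * alpha i j u * - dist2 m (x j u) (x i u))))
            by ring.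
          rewrite <- rsum_scal; apply rsum_ext; intros i' _.
          rewrite <- rsum_scal; apply rsum_ext; intros j' _; unfold D; ring. }
      assert (w i * alpha i j u * th <= w i * alpha i j u * dist2 m (x j u) (x i u)).
      { apply Rmult_le_compat_l; [|lra]; apply Rmult_le_pos; [apply Rlt_le; auto|].
        apply alpha_bound; auto; lra. }
      lra.
    - intros u Hu; rewrite Rabs_mult, Rabs_Ropp.
      destruct (alpha_bound i j u Hi Hj ltac:(lra)) as [Ha1 Ha2].
      apply Rmult_le_compat_l; [apply Rabs_pos|now rewrite Rabs_pos_eq].
    - now apply HK_integral_scal. }
  specialize (HV T HsT); specialize (Hw i Hi).
  assert (th * w0 * delta <= th * w i * I).
  { apply Rmult_le_compat; try lra; [apply Rmult_le_pos; lra|apply Rmult_le_compat_l; lra]. }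
  lra.
Qed.

(** One merge lowers the number of available labels by one. The tolerance [e0] and the time [T] are
    chosen before [s] and [cl], so that merges can be chained. *)
Lemma merge_clusters (n : nat) (e : R) : e > 0 ->
  exists e0 T, e0 > 0 /\ forall s cl, T <= s ->
    (forall i, (i < N)%nat -> (cl i < S (S n))%nat) -> tight e0 cl s ->
    exists t cl', s <= t /\ (forall i, (i < N)%nat -> (cl' i < S n)%nat) /\ tight e cl' t.
Proof.
  intros He.
  destruct weight_lower_bound as [w0 [Hw0 Hw]].
  destruct state_bounded as [r [Hr Hb]].
  destruct cluster_solution as [c [Hc Hsol]].
  (* If members are within [e / 48] of their anchor, clusters are tight up to [e / 12]; bridging two
     of them through a pair at squared distance [th] gives at most [(2 + 4 + 4) / 12] times [e]. *)
  set (th := e / 12).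
  (* Cost of a crossing arc: [6 * r + 4] for an agent to its anchor plus [8 * r + 8] between two
     anchors. *)
  set (D := 14 * r + 12).
  (* The allowance [e * w0 / 48] for [W] is halved between its initial value and its growth;
     [om <= 1] keeps the anchors bounded. *)
  set (om := Rmin 1 (e * w0 / 48 / 2)).
  assert (Hew : 0 < e * w0) by (apply Rmult_lt_0_compat; lra).
  assert (Hom : 0 < om /\ om <= 1 /\ om <= e * w0 / 48 / 2).
  { unfold om; split; [apply Rmin_pos; lra|split; [apply Rmin_l|apply Rmin_r]]. }
  set (b := om / (2 * c + 1)).
  assert (Hbpos : 0 < b) by (apply Rdiv_lt_0_compat; lra).
  set (e0 := Rmin b e).
  assert (He0 : 0 < e0 /\ e0 <= b /\ e0 <= e).
  { unfold e0; split; [apply Rmin_pos; lra|split; [apply Rmin_l|apply Rmin_r]]. }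
  assert (Hcom : c * (e0 + b) <= om).
  { apply Rle_trans with ((2 * c + 1) * b); [nra|].
    unfold b; right; field; lra. }
  (* The first bound on the energy left limits the growth of [W] to [om]; the second forces clusters
     to meet. *)
  set (g := Rmin (om * (th / D)) (th * w0 * delta)).
  assert (HthD : 0 < th / D) by (apply Rdiv_lt_0_compat; unfold th, D; lra).
  assert (Hg : 0 < g /\ g <= om * (th / D) /\ g <= th * w0 * delta).
  { unfold g; split; [apply Rmin_pos|split; [apply Rmin_l|apply Rmin_r]].
    - apply Rmult_lt_0_compat; lra.
    - apply Rmult_lt_0_compat; [apply Rmult_lt_0_compat; unfold th; lra|lra]. }
  destruct (resid_vanishes b Hbpos) as [T1 HT1].
  destruct (energy_cauchy g) as [T2 [HT20 HT2]]; [lra|].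
  exists e0, (Rmax T1 T2); split; [lra|]; intros s cl Hs Hcl Hti.
  pose proof (Rmax_l T1 T2); pose proof (Rmax_r T1 T2).
  destruct (classic (exists i0 j0, (i0 < N)%nat /\ (j0 < N)%nat /\ cl i0 <> cl j0))
    as [(i0 & j0 & Hi0 & Hj0 & Hne)|Hsame].
  2:{ exists s, (fun _ => O); split; [lra|split; [lia|]]; intros i j Hi Hj _.
      apply Rle_trans with e0; [|lra]; apply Hti; auto.
      apply NNPP; intros Hij; apply Hsame; now exists i, j. }
  destruct (Hsol cl e0 b s ltac:(lra) ltac:(lra) Hti (HT1 s ltac:(lra))) as [q Hq].
  set (C := fun t => exists i j, (i < N)%nat /\ (j < N)%nat /\ cl i <> cl j /\
              dist2 m (x i t) (x j t) <= th).
  assert (HnC : forall t, ~ C t -> forall i j, (i < N)%nat -> (j < N)%nat -> cl i <> cl j ->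
            th < dist2 m (x i t) (x j t)).
  { intros t Hno i j Hi Hj Hij; apply Rnot_le_lt; intros Hle; apply Hno; now exists i, j. }
  destruct (clusters_meet w0 th s cl i0 j0) as [t0 [Hst0 HCt0]]; auto; try (unfold th; lra).
  { intros t Hst; specialize (HT2 s t ltac:(lra) Hst); lra. }
  destruct (first_time C s t0 Hst0 HCt0) as [t1 [Hst1 [HC1 Hbefore]]].
  { intros t Ht Hno.
    destruct (separation_persists cl th t0 t ltac:(lra) (HnC t Hno)) as [d [Hd Hnear]].
    exists d; split; [exact Hd|]; intros u Hu Hut (i & j & Hi & Hj & Hij & Hle).
    specialize (Hnear i j u Hi Hj Hij ltac:(lra) Hut); lra. }
  set (W := wdist2 (fun i => q (cl i))).
  set (cost := fun i j => if Nat.eqb (cl i) (cl j) then 0 else D).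
  assert (HqS : forall i, (i < N)%nat -> dist2 m (q (cl i)) y <= 2 + 2 * r).
  { intros i Hi; eapply Rle_trans; [apply (dist2_triangle m _ (x i s))|].
    rewrite (dist2_sym m (q (cl i))); destruct (Hq i Hi) as [_ Hqi].
    pose proof (Hb i s Hi ltac:(lra)); lra. }
  (* Before the first meeting, an arc across clusters raises [W] at rate at most [D] per unit of
     weight but drains [V] at rate at least [th], so [W + D / th * V] cannot increase. *)
  assert (HW : W t1 + D / th * V t1 - (W s + D / th * V s) <= 0 * (t1 - s)).
  { apply (ac_increment_le_const (fun u => W u + D / th * V u) P); auto; try lra.
    - apply loc_ac_plus; [apply loc_ac_wdist2|apply loc_ac_scal, loc_ac_wdist2].
    - intros u Hu HPu.
      destruct (energy_rate u ltac:(lra) HPu) as [dV [HdV HleV]].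
      destruct (wdist2_rate (fun i => q (cl i)) cost u ltac:(lra) HPu) as [dW [HdW HleW]].
      { intros i Hi; now apply Hq. }
      { intros i j Hi Hj; unfold cost; destruct (Nat.eqb_spec (cl i) (cl j)) as [Heq|Hij].
        - rewrite Heq, dot_polar; pose proof (dist2_nonneg m (x j u) (x i u)); lra.
        - eapply Rle_trans; [apply (dot_cross_le m _ _ _ (q (cl j)))|].
          assert (dist2 m (x i u) (q (cl i)) <= 6 * r + 4).
          { eapply Rle_trans; [apply (dist2_triangle m _ y)|]; rewrite (dist2_sym m y).
            pose proof (Hb i u Hi ltac:(lra)); pose proof (HqS i Hi); lra. }
          assert (dist2 m (q (cl j)) (q (cl i)) <= 8 * r + 8).
          { eapply Rle_trans; [apply (dist2_triangle m _ y)|]; rewrite (dist2_sym m y).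
            pose proof (HqS i Hi); pose proof (HqS j Hj); lra. }
          unfold D; lra. }
      exists (dW + D / th * dV); split.
      + apply (derivable_pt_lim_plus W (fun v => D / th * V v)); [exact HdW|].
        now apply derivable_pt_lim_scal.
      + pose proof (wresid_nonneg u) as Hres.
        assert (HDth : 0 < D / th) by (apply Rdiv_lt_0_compat; unfold th, D; lra).
        assert (HV2 : D / th * dV <= D / th *
           rsum N (fun i => rsum N (fun j => w i * alpha i j u * - dist2 m (x j u) (x i u))))
          by (apply Rmult_le_compat_l; lra).
        assert (Hsum : rsum N (fun i => rsum N (fun j => w i * alpha i j u * cost i j))
           + D / th *
           rsum N (fun i => rsum N (fun j => w i * alpha i j u * - dist2 m (x j u) (x i u))) <= 0).
        { rewrite <- rsum_scal, <- rsum_plus, <- (rsum_0 N (fun _ => 0)) by auto.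
          apply rsum_le; intros i Hi.
          rewrite <- rsum_scal, <- rsum_plus, <- (rsum_0 N (fun _ => 0)) by auto.
          apply rsum_le; intros j Hj.
          assert (Hwa : 0 <= w i * alpha i j u).
          { apply Rmult_le_pos; [apply Rlt_le; auto|apply alpha_bound; auto; lra]. }
          assert (Hcost : cost i j <= D / th * dist2 m (x j u) (x i u)).
          { unfold cost; destruct (Nat.eqb_spec (cl i) (cl j)) as [Heq|Hij].
            - apply Rmult_le_pos; [lra|apply dist2_nonneg].
            - replace D with (D / th * th) at 1 by (field; unfold th; lra).
              apply Rmult_le_compat_l; [lra|].
              rewrite dist2_sym; apply Rlt_le, (HnC u); auto; apply Hbefore; lra. }
          apply Rmult_le_compat_l with (r := w i * alpha i j u) in Hcost; [|exact Hwa].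
          lra. }
        lra. }
  assert (HWs : W s <= om).
  { apply wdist2_le; intros i Hi; destruct (Hq i Hi); lra. }
  assert (HVd : D / th * (V s - V t1) <= om).
  { apply Rle_trans with (D / th * (om * (th / D))).
    - apply Rmult_le_compat_l; [apply Rlt_le, Rdiv_lt_0_compat; unfold th, D; lra|].
      specialize (HT2 s t1 ltac:(lra) Hst1); lra.
    - right; field; unfold th, D; lra. }
  assert (HW1 : W t1 <= e * w0 / 48) by lra.
  assert (Hclose : forall i, (i < N)%nat -> dist2 m (x i t1) (q (cl i)) <= e / 48).
  { intros i Hi.
    eapply Rle_trans; [apply (dist2_le_wdist2 w0 (fun i => q (cl i)) i t1 Hw0 Hw Hi)|].
    replace (e / 48) with (e * w0 / 48 / w0) by (field; lra).
    apply Rmult_le_compat_r; [apply Rlt_le, Rinv_0_lt_compat; lra|exact HW1]. }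
  assert (Hti1 : tight (e / 12) cl t1).
  { intros i j Hi Hj Hij; eapply Rle_trans; [apply (dist2_triangle m _ (q (cl i)))|].
    rewrite (dist2_sym m (q (cl i))), Hij at 1.
    pose proof (Hclose i Hi); pose proof (Hclose j Hj) as Hj'; rewrite <- Hij in *; lra. }
  assert (HC1' : exists i1 j1, (i1 < N)%nat /\ (j1 < N)%nat /\ (cl i1 < cl j1)%nat /\
            dist2 m (x i1 t1) (x j1 t1) <= th).
  { destruct HC1 as (i & j & Hi & Hj & Hij & Hle).
    destruct (Nat.lt_ge_cases (cl i) (cl j)); [now exists i, j|].
    exists j, i; rewrite dist2_sym; repeat split; auto; lia. }
  destruct HC1' as (i1 & j1 & Hi1 & Hj1 & Hlt & Hle).
  (* The cluster of [j1] takes the smaller label [cl i1], and the top label [S n] moves into the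
     freed label [cl j1]; all labels are then below [S n]. *)
  exists t1, (fun i => if Nat.eqb (cl i) (cl j1) then cl i1
                       else if Nat.eqb (cl i) (S n) then cl j1 else cl i).
  split; [exact Hst1|split].
  - intros i Hi; pose proof (Hcl i Hi); pose proof (Hcl j1 Hj1).
    destruct (Nat.eqb_spec (cl i) (cl j1)); [lia|].
    destruct (Nat.eqb_spec (cl i) (S n)); lia.
  - assert (Hbridge : forall i j, (i < N)%nat -> (j < N)%nat -> cl i = cl i1 -> cl j = cl j1 ->
              dist2 m (x i t1) (x j t1) <= e).
    { intros i j Hi Hj Hci Hcj.
      pose proof (Hti1 i i1 Hi Hi1 Hci); pose proof (Hti1 j1 j Hj1 Hj (eq_sym Hcj)).
      eapply Rle_trans; [apply (dist2_triangle m _ (x i1 t1))|].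
      pose proof (dist2_triangle m (x i1 t1) (x j1 t1) (x j t1)); unfold th in *; lra. }
    intros i j Hi Hj Hij; pose proof (Hcl i Hi); pose proof (Hcl j Hj); pose proof (Hcl j1 Hj1).
    assert (Hcases : cl i = cl j \/ (cl i = cl i1 /\ cl j = cl j1) \/
                     (cl j = cl i1 /\ cl i = cl j1)).
    { destruct (Nat.eqb_spec (cl i) (cl j1)), (Nat.eqb_spec (cl j) (cl j1)),
        (Nat.eqb_spec (cl i) (S n)), (Nat.eqb_spec (cl j) (S n)); lia. }
    destruct Hcases as [Heq|[[Hi' Hj']|[Hj' Hi']]].
    + specialize (Hti1 i j Hi Hj Heq); lra.
    + now apply Hbridge.
    + rewrite dist2_sym; now apply Hbridge.
Qed.

(** Merges are chained backwards, each tolerance being chosen from the next one. The chain starts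
    from singletons, labelled by the identity, which are tight for every tolerance. *)
Lemma eventually_all_close (e : R) : e > 0 ->
  exists T, forall s, T <= s -> exists t, s <= t /\ tight e (fun _ => O) t.
Proof.
  intros He.
  assert (Hn : forall n, exists e0 T, e0 > 0 /\ forall s cl, T <= s ->
    (forall i, (i < N)%nat -> (cl i < S n)%nat) -> tight e0 cl s ->
    exists t, s <= t /\ tight e (fun _ => O) t).
  { induction n as [|n (e1 & T1 & He1 & IH)].
    - exists e, 0; split; [exact He|]; intros s cl _ Hcl Hti; exists s; split; [lra|].
      intros i j Hi Hj _; apply Hti; auto; pose proof (Hcl i Hi); pose proof (Hcl j Hj); lia.
    - destruct (merge_clusters n e1 He1) as (e0 & T0 & He0 & Hm).
      exists e0, (Rmax T0 T1); split; [exact He0|]; intros s cl Hs Hcl Hti.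
      pose proof (Rmax_l T0 T1); pose proof (Rmax_r T0 T1).
      destruct (Hm s cl ltac:(lra) Hcl Hti) as (t & cl' & Hst & Hcl' & Hti').
      destruct (IH t cl' ltac:(lra) Hcl' Hti') as (t' & Htt' & Hfin).
      exists t'; split; [lra|exact Hfin]. }
  destruct (Hn N) as (e0 & T & He0 & H); exists T; intros s Hs.
  apply (H s (fun i => i) Hs); [lia|]; intros i j _ _ <-; rewrite dist2_refl; lra.
Qed.

(** * The conserved mean and convergence *)

(** Along a kernel vector both flows reduce to plain consensus, whose weighted mean is constant by
    balance. *)
Lemma kernel_mean_conserved (v : vec) (t : R) : 0 <= t ->
  (forall k, (k < N)%nat -> dot m (h k) v = 0) ->
  rsum N (fun i => w i * dot m v (x i t)) = rsum N (fun i => w i * dot m v (x i 0)).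
Proof.
  intros Ht Hv.
  apply (ac_constant (fun t => rsum N (fun i => w i * dot m v (x i t))) P); auto.
  - apply (loc_ac_rsum N (fun i t => w i * dot m v (x i t))); intros i Hi.
    now apply loc_ac_scal, loc_ac_dot.
  - intros u Hu HPu.
    eapply derivable_pt_lim_eq.
    + apply (derivable_pt_lim_rsum N (fun i t => w i * dot m v (x i t))); intros i Hi.
      apply derivable_pt_lim_scal, kernel_deriv; auto.
    + rewrite <- (balanced_difference_sum (fun i => dot m v (x i u)) u) by lra.
      apply rsum_ext; intros i _; rewrite <- rsum_scal; apply rsum_ext; intros; ring.
Qed.

(** At one suitable time all agents are close to a single solution [q]. Then [v = q - y] lies in the
    kernel, and conservation makes [|v|^2] the weighted mean of [v . (q - x_i)], at most
    [|v|^2 / 2 + om / 2]. So [q] is close to [y], the energy is small at that time, and monotonicity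
    keeps it small. *)
Lemma balanced_flow_converges :
  (forall v, (forall k, (k < N)%nat -> dot m (h k) v = 0) ->
     rsum N (fun i => w i * dot m v (x i 0)) = dot m v y) ->
  forall i, (i < N)%nat -> vec_lim m (x i) y.
Proof.
  intros Hy i Hi eps Heps.
  destruct weight_lower_bound as [w0 [Hw0 Hw]].
  destruct cluster_solution as [c [Hc Hsol]].
  (* Chosen so that the final energy bound [4 * om], divided by [w0], is [eps * eps / 2]. *)
  set (om := eps * eps * w0 / 8).
  assert (Hom : 0 < om).
  { unfold om; assert (0 < eps * eps * w0); [|lra].
    apply Rmult_lt_0_compat; [apply Rmult_lt_0_compat|]; lra. }
  set (e := om / (2 * c + 1)).
  assert (He : 0 < e) by (apply Rdiv_lt_0_compat; lra).
  assert (Hce : c * (e + e) <= om).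
  { apply Rle_trans with ((2 * c + 1) * e); [nra|]; unfold e; right; field; lra. }
  destruct (resid_vanishes e He) as [T1 HT1].
  destruct (eventually_all_close e He) as [T2 HT2].
  set (s := Rmax 0 (Rmax T1 T2)).
  assert (Hs : 0 <= s /\ T1 <= s /\ T2 <= s).
  { unfold s; pose proof (Rmax_l 0 (Rmax T1 T2)); pose proof (Rmax_r 0 (Rmax T1 T2)).
    pose proof (Rmax_l T1 T2); pose proof (Rmax_r T1 T2); lra. }
  destruct (HT2 s) as [t [Hst Hti]]; [lra|].
  destruct (Hsol (fun _ => O) e e t ltac:(lra) ltac:(lra) Hti (HT1 t ltac:(lra))) as [q Hq].
  set (v := vsub (q O) y).
  assert (Hv : forall k, (k < N)%nat -> dot m (h k) v = 0).
  { intros k Hk; unfold v; rewrite dot_sub_r, (y_sol k Hk).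
    destruct (Hq k Hk) as [Hqk _]; unfold inAi in Hqk; lra. }
  assert (Hvv : dot m v v <= om).
  { assert (H : dot m v v = rsum N (fun i => w i * dot m v (vsub (q O) (x i t)))).
    { rewrite (rsum_ext N _ (fun i => dot m v (q O) * w i - w i * dot m v (x i t)))
        by (intros; rewrite dot_sub_r; ring).
      rewrite rsum_minus, rsum_scal, w_sum, kernel_mean_conserved, Hy by (auto; lra).
      unfold v at 2; rewrite dot_sub_r; ring. }
    assert (H' : rsum N (fun i => w i * dot m v (vsub (q O) (x i t)))
                 <= rsum N (fun i => (dot m v v / 2 + om / 2) * w i)).
    { apply rsum_le; intros k Hk; rewrite (Rmult_comm _ (w k)).
      apply Rmult_le_compat_l; [apply Rlt_le; auto|].
      destruct (Hq k Hk) as [_ Hqk]; rewrite dist2_sym in Hqk; unfold dist2 in Hqk.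
      set (u := vsub (q O) (x k t)) in *.
      assert (Hx : 0 <= dot m v v - 2 * 1 * dot m v u + 1 * 1 * dot m u u)
        by (rewrite <- dist2_expand; apply dist2_nonneg).
      lra. }
    rewrite rsum_scal, w_sum in H'; lra. }
  assert (HVt : V t <= 4 * om).
  { apply wdist2_le; intros k Hk.
    eapply Rle_trans; [apply (dist2_triangle m _ (q O))|].
    destruct (Hq k Hk) as [_ Hqk]; unfold dist2 at 2; fold v; lra. }
  exists t; intros t' Ht'.
  assert (Hd : dist2 m (x i t') y < eps * eps).
  { eapply Rle_lt_trans; [apply (dist2_le_wdist2 w0 (fun _ => y) i t' Hw0 Hw Hi)|].
    apply Rle_lt_trans with (4 * om / w0).
    - apply Rmult_le_compat_r; [apply Rlt_le, Rinv_0_lt_compat; lra|].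
      pose proof (energy_nonincreasing t t' ltac:(lra) ltac:(lra)); unfold V in *; lra.
    - replace (4 * om / w0) with (eps * eps / 2) by (unfold om; field; lra).
      assert (0 < eps * eps) by (apply Rmult_lt_0_compat; lra); lra. }
  unfold vnorm; fold (dist2 m (x i t') y).
  rewrite <- (sqrt_square eps) by lra.
  apply sqrt_lt_1_alt; split; [apply dist2_nonneg|exact Hd].
Qed.

End AroundSolution.
End BalancedFlow.

(** * The two network flows *)

Lemma derivable_pt_lim_dot (m : nat) (v : vec) (f : R -> vec) (d : vec) (t : R) :
  (forall k, (k < m)%nat -> derivable_pt_lim (fun s => f s k) t (d k)) ->
  derivable_pt_lim (fun s => dot m v (f s)) t (dot m v d).
Proof.
  intros H; apply (derivable_pt_lim_rsum m (fun k s => v k * f s k)); intros k Hk.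
  apply derivable_pt_lim_scal; auto.
Qed.

Lemma derivable_pt_lim_dist2 (m : nat) (q : vec) (f : R -> vec) (d : vec) (t : R) :
  (forall k, (k < m)%nat -> derivable_pt_lim (fun s => f s k) t (d k)) ->
  derivable_pt_lim (fun s => dist2 m (f s) q) t (2 * dot m (vsub (f t) q) d).
Proof.
  intros H.
  apply (derivable_pt_lim_eq _ t
           (rsum m (fun k => d k * vsub (f t) q k + vsub (f t) q k * d k))).
  - apply (derivable_pt_lim_rsum m (fun k s => vsub (f s) q k * vsub (f s) q k)); intros k Hk.
    assert (Hs : derivable_pt_lim (fun s => vsub (f s) q k) t (d k)).
    { apply (derivable_pt_lim_eq _ t (d k - 0)); [|ring].
      apply (derivable_pt_lim_minus (fun s => f s k) (fun _ => q k)); auto.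
      apply derivable_pt_lim_const. }
    now apply (derivable_pt_lim_mult (fun s => vsub (f s) q k) (fun s => vsub (f s) q k)).
  - unfold dot; rewrite <- rsum_scal; apply rsum_ext; intros; ring.
Qed.

Lemma dot_cp_rhs (N m : nat) (h : nat -> vec) (z : nat -> R) (K : R)
  (E : R -> nat -> nat -> bool) (a : nat -> nat -> R -> R) (t : R) (X : nat -> vec)
  (i : nat) (v : vec) :
  dot m v (cp_rhs N m h z K E a t X i) =
  rsum N (fun j => K * arcw E a j i t * dot m v (vsub (X j) (X i)))
  - (dot m (h i) (X i) - z i) * dot m v (h i).
Proof.
  transitivity (dot m v (fun k => rsum N (fun j => K * arcw E a j i t * vsub (X j) (X i) k)
                                  + (- (dot m (h i) (X i) - z i)) * h i k)).
  - apply rsum_ext; intros k _; f_equal; unfold cp_rhs, projAi.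
    rewrite <- rsum_scal.
    rewrite (rsum_ext N _ (fun j => K * arcw E a j i t * vsub (X j) (X i) k)); [ring|].
    intros j _; unfold arcw, vsub; destruct (E t j i); ring.
  - rewrite dot_plus_r, (dot_rsum_r m N v _ (fun j => vsub (X j) (X i))), dot_scal_r; ring.
Qed.

(** The factor 1 stands where the other flow has [K], so that both flows take the same form. *)
Lemma dot_pc_rhs (N m : nat) (h : nat -> vec) (z : nat -> R)
  (E : R -> nat -> nat -> bool) (a : nat -> nat -> R -> R) (t : R) (X : nat -> vec)
  (i : nat) (v : vec) :
  dot m v (pc_rhs N m h z E a t X i) =
  rsum N (fun j => 1 * arcw E a j i t *
     (dot m v (vsub (X j) (X i)) - dot m (h i) (vsub (X j) (X i)) * dot m v (h i))).
Proof.
  transitivity (dot m v (fun k => rsum N (fun j => 1 * arcw E a j i t *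
    (fun k => vsub (X j) (X i) k + (- dot m (h i) (vsub (X j) (X i))) * h i k) k))).
  - apply rsum_ext; intros k _; f_equal; apply rsum_ext; intros j _.
    unfold arcw, projAi; rewrite dot_sub_r; unfold vsub; destruct (E t j i); ring.
  - rewrite dot_rsum_r; apply rsum_ext; intros j _; rewrite dot_plus_r, dot_scal_r; ring.
Qed.

(** * Connectivity expressed through cuts *)

(** What both kinds of joint connectivity provide: any nonconstant labelling is crossed, in one
    direction or the other, by an arc of sufficient weight in a finite window after [s]. *)
Definition joins_cuts (N : nat) (E : R -> nat -> nat -> bool) (a : nat -> nat -> R -> R)
  (delta : R) : Prop :=
  forall s (cl : nat -> nat) i0 j0, 0 <= s -> (i0 < N)%nat -> (j0 < N)%nat -> cl i0 <> cl j0 ->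
  exists i j T, (i < N)%nat /\ (j < N)%nat /\ cl i <> cl j /\ s <= T /\
    delta_arc E a delta s T j i.

Lemma reach_crosses (Rel : nat -> nat -> Prop) (cl : nat -> nat) (i j : nat) :
  reach Rel i j -> cl i <> cl j -> exists u v, Rel u v /\ cl u <> cl v.
Proof.
  induction 1 as [i|i j k Hij _ IH]; intros Hne; [tauto|].
  destruct (Nat.eq_dec (cl i) (cl j)) as [Heq|Hij']; [apply IH; congruence|now exists i, j].
Qed.

Lemma UJSC_joins_cuts N E a delta : UJSC N E a delta -> joins_cuts N E a delta.
Proof.
  intros [T [HT H]] s cl i0 j0 Hs Hi0 Hj0 Hne.
  destruct (reach_crosses _ cl _ _ (H s ltac:(lra) i0 j0 Hi0 Hj0) Hne)
    as (u & v & (Hu & Hv & Harc) & Huv).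
  exists v, u, (s + T); repeat split; auto; lra.
Qed.

(** An improper integral of at least [delta] guarantees only smaller values on finite windows; hence
    [delta / 2]. *)
Lemma BIJC_joins_cuts N E a delta :
  delta > 0 -> BIJC N E a delta -> joins_cuts N E a (delta / 2).
Proof.
  intros Hd [_ H] s cl i0 j0 Hs Hi0 Hj0 Hne.
  destruct (reach_crosses _ cl _ _ (H s ltac:(lra) i0 j0 Hi0 Hj0) Hne)
    as (u & v & (Hu & Hv & [Harc|Harc]) & Huv);
    destruct (Harc (delta / 2) ltac:(lra)) as [T [HT HI]].
  - exists v, u, T; repeat split; auto; lra.
  - exists u, v, T; repeat split; auto; lra.
Qed.

(** Moving [p] along a kernel vector stays in the solution set, so minimality makes [u - p]
    orthogonal to it. This identifies the kernel part of the mean of the projections with that of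
    the initial mean. *)
Lemma is_proj_orthogonal (N m : nat) (h : nat -> vec) (z : nat -> R) (u p v : vec) :
  is_proj m (inA N m h z) u p -> (forall k, (k < N)%nat -> dot m (h k) v = 0) ->
  dot m v u = dot m v p.
Proof.
  intros [Hp Hmin] Hv.
  set (b := dot m (vsub u p) v); set (n := dot m v v).
  assert (Hn : 0 <= n) by apply dot_nonneg.
  (* The minimiser would be [b / n]; with [1 + n] there is no division by zero, and the distance
     still decreases strictly unless [b = 0]. *)
  set (c := b / (1 + n)).
  assert (Hq : inA N m h z (fun k => p k + c * v k)).
  { intros i Hi; unfold inAi; rewrite dot_plus_r, dot_scal_r, Hv by exact Hi.
    rewrite (Hp i Hi); ring. }
  specialize (Hmin _ Hq); unfold vnorm in Hmin.
  apply sqrt_le_0 in Hmin; try apply dot_nonneg.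
  replace (dot m (vsub u (fun k => p k + c * v k)) (vsub u (fun k => p k + c * v k)))
    with (dist2 m (vsub u p) (fun k => c * v k)) in Hmin
    by (apply rsum_ext; intros; unfold vsub; ring).
  rewrite dist2_expand in Hmin; fold b n in Hmin.
  assert (Hc : 0 <= c * (c * n - 2 * b)) by lra.
  replace (c * (c * n - 2 * b)) with (- (b * b * (2 + n) / ((1 + n) * (1 + n)))) in Hc
    by (unfold c; field; lra).
  assert (Hpos : 0 < (2 + n) / ((1 + n) * (1 + n))) by (apply Rdiv_lt_0_compat; nra).
  replace (b * b * (2 + n) / ((1 + n) * (1 + n)))
    with (b * b * ((2 + n) / ((1 + n) * (1 + n)))) in Hc by (field; lra).
  assert (Hb : b = 0).
  { apply Rsqr_0_uniq, Rle_antisym; [|apply Rle_0_sqr]; unfold Rsqr.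
    apply Rmult_le_reg_r with (1 := Hpos); lra. }
  unfold b in Hb; rewrite dot_sym, dot_sub_r in Hb; lra.
Qed.

(** Covers both parts of the theorem, with [w] equal to [1 / N] or to the left null vector. *)
Lemma flow_converges (N m : nat) (h : nat -> vec) (z : nat -> R)
  (E : R -> nat -> nat -> bool) (a : nat -> nat -> R -> R) (astar delta : R)
  (x : nat -> R -> vec) (p : nat -> vec) (w : nat -> R) :
  (forall i, (i < N)%nat -> dot m (h i) (h i) = 1) ->
  (forall i j t, (i < N)%nat -> (j < N)%nat -> t >= 0 -> 0 < a i j t <= astar) ->
  astar > 0 ->
  ((exists K, K > 0 /\ is_solution N m (cp_rhs N m h z K E a) x) \/
   (is_solution N m (pc_rhs N m h z E a) x /\
    forall i, (i < N)%nat -> inAi m h z i (x i 0))) ->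
  (forall j, (j < N)%nat -> is_proj m (inA N m h z) (x j 0) (p j)) ->
  (forall i, (i < N)%nat -> 0 < w i) -> rsum N w = 1 ->
  (forall i t, (i < N)%nat -> t >= 0 ->
     w i * rsum N (fun j => arcw E a j i t) = rsum N (fun j => w j * arcw E a i j t)) ->
  delta > 0 -> joins_cuts N E a delta ->
  forall i, (i < N)%nat -> vec_lim m (x i) (fun k => rsum N (fun j => w j * p j k)).
Proof.
  intros Hh Ha Hastar Hflow Hp Hw Hw1 Hbal Hdelta Hcuts.
  (* All that is needed of either flow: its form when tested against kernel vectors and against
     [x_i - q] with [q] in [A_i], and a bound on its component along [h i]. *)
  assert (HK : exists K rhs, K > 0 /\ is_solution N m rhs x /\ forall t, 0 < t ->
    (forall i k, (i < N)%nat -> (k < m)%nat ->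
       derivable_pt_lim (fun s => x i s k) t (rhs t (fun j => x j t) i k)) ->
    forall i, (i < N)%nat ->
    (forall v, (forall k, (k < N)%nat -> dot m (h k) v = 0) \/
               (exists q, inAi m h z i q /\ v = vsub (x i t) q) ->
       dot m v (rhs t (fun j => x j t) i) =
       rsum N (fun j => K * arcw E a j i t * dot m v (vsub (x j t) (x i t)))
       - (dot m (h i) (x i t) - z i) * dot m v (h i)) /\
    Rabs (dot m (h i) (rhs t (fun j => x j t) i)) <=
       rsum N (fun j => K * arcw E a j i t * Rabs (dot m (h i) (vsub (x j t) (x i t))))
       + Rabs (dot m (h i) (x i t) - z i)).
  { assert (Harc : forall i j t, (i < N)%nat -> (j < N)%nat -> 0 < t -> 0 <= arcw E a j i t).
    { intros i j t Hi Hj Ht; unfold arcw; destruct (E t j i); [|lra].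
      apply Rlt_le, Ha; auto; lra. }
    destruct Hflow as [[K [HK Hsol]]|[Hsol Hinit]].
    - exists K, (cp_rhs N m h z K E a); split; [exact HK|split; [exact Hsol|]].
      intros t Ht _ i Hi; split; [intros v _; apply dot_cp_rhs|].
      rewrite dot_cp_rhs, Hh, Rmult_1_r by exact Hi.
      unfold Rminus at 1; eapply Rle_trans; [apply Rabs_triang|].
      rewrite Rabs_Ropp; apply Rplus_le_compat_r.
      eapply Rle_trans; [apply rsum_abs|]; apply rsum_le; intros j Hj.
      rewrite Rabs_mult, (Rabs_pos_eq (K * _)); [lra|].
      apply Rmult_le_pos; [lra|now apply Harc].
    - exists 1, (pc_rhs N m h z E a); split; [lra|split; [exact Hsol|]].
      intros t Ht _ i Hi.
      (* As [h i] is a unit vector, the projected velocity has no component along it: [A_i] is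
         invariant and the residual is identically zero. *)
      assert (Hstay : dot m (h i) (x i t) = z i).
      { destruct Hsol as [Hac Hae]; rewrite <- (Hinit i Hi).
        apply (ac_constant (fun t => dot m (h i) (x i t)) _ t) with (2 := Hae); [|lra|].
        - apply (loc_ac_rsum m (fun k t => h i k * x i t k)); intros k Hk.
          apply loc_ac_scal; intros T HT; now apply Hac.
        - intros u Hu HPu.
          apply (derivable_pt_lim_eq _ u
                   (dot m (h i) (pc_rhs N m h z E a u (fun j => x j u) i))).
          + apply derivable_pt_lim_dot; intros k Hk; now apply HPu.
          + rewrite dot_pc_rhs, Hh by exact Hi; apply rsum_0; intros; ring. }
      rewrite Hstay, Rminus_diag; split.
      + intros v Hv; rewrite dot_pc_rhs, Rmult_0_l, Rminus_0_r; apply rsum_ext; intros j Hj.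
        assert (Hvi : dot m v (h i) = 0).
        { rewrite dot_sym; destruct Hv as [Hv|[q [Hq ->]]]; [now apply Hv|].
          rewrite dot_sub_r, Hstay, Hq; ring. }
        rewrite Hvi; ring.
      + rewrite dot_pc_rhs, rsum_0, Rabs_R0, Rplus_0_r
          by (intros; rewrite Hh by exact Hi; ring).
        apply rsum_nonneg; intros j Hj; apply Rmult_le_pos; [|apply Rabs_pos].
        rewrite Rmult_1_l; now apply Harc. }
  destruct HK as (K & rhs & HK & [Hac Hae] & Hrhs).
  assert (Hy : inA N m h z (fun k => rsum N (fun j => w j * p j k))).
  { intros i Hi; unfold inAi; rewrite dot_rsum_r.
    rewrite (rsum_ext N _ (fun j => z i * w j)).
    - rewrite rsum_scal, Hw1; ring.
    - intros j Hj; destruct (Hp j Hj) as [Hpj _]; rewrite (Hpj i Hi); ring. }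
  apply (balanced_flow_converges N m h z x (fun i j t => K * arcw E a j i t) w (K * astar)
           (K * delta) _) with (y := fun k => rsum N (fun j => w j * p j k)) (7 := Hae); auto.
  - intros i j t Hi Hj Ht; unfold arcw; destruct (E t j i); [|nra].
    destruct (Ha i j t Hi Hj) as [H1 H2]; [lra|].
    split; [apply Rmult_le_pos; lra|apply Rmult_le_compat_l; lra].
  - intros i t Hi Ht; specialize (Hbal i t Hi ltac:(lra)).
    rewrite <- rsum_scal in Hbal.
    rewrite (rsum_ext N _ (fun j => K * (w i * arcw E a j i t))) by (intros; ring).
    rewrite (rsum_ext N (fun j => w j * _) (fun j => K * (w j * arcw E a i j t)))
      by (intros; ring).
    now rewrite !rsum_scal, <- Hbal, rsum_scal.
  - intros t i q Ht HPt Hi Hq.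
    eapply derivable_pt_lim_eq.
    + apply derivable_pt_lim_dist2; intros k Hk; now apply HPt.
    + destruct (Hrhs t Ht HPt i Hi) as [Hdot _].
      rewrite Hdot by (right; now exists q).
      rewrite (dot_sym m _ (h i)), dot_sub_r, Hq, Rmult_minus_distr_l, <- rsum_scal.
      apply (f_equal2 Rminus); [apply rsum_ext; intros; ring|unfold resid, Rsqr; ring].
  - intros t i v Ht HPt Hi Hv.
    eapply derivable_pt_lim_eq.
    + apply derivable_pt_lim_dot; intros k Hk; now apply HPt.
    + destruct (Hrhs t Ht HPt i Hi) as [Hdot _].
      rewrite Hdot, (dot_sym m v (h i)), Hv by auto; rewrite Rmult_0_r, Rminus_0_r.
      apply rsum_ext; intros; now rewrite dot_sub_r.
  - intros t i Ht HPt Hi; destruct (Hrhs t Ht HPt i Hi) as [_ Hres].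
    exists (dot m (h i) (rhs t (fun j => x j t) i)); split; [|exact Hres].
    apply (derivable_pt_lim_eq _ t (dot m (h i) (rhs t (fun j => x j t) i) - 0)); [|ring].
    apply (derivable_pt_lim_minus (fun s => dot m (h i) (x i s)) (fun _ => z i)).
    + apply derivable_pt_lim_dot; intros k Hk; now apply HPt.
    + apply derivable_pt_lim_const.
  - now apply Rmult_lt_0_compat.
  - intros s cl i0 j0 Hs Hi0 Hj0 Hne.
    destruct (Hcuts s cl i0 j0 Hs Hi0 Hj0 Hne) as (i & j & T & Hi & Hj & Hij & HT & I & HI & HId).
    exists i, j, T, (K * I); repeat split; auto.
    + now apply HK_integral_scal.
    + apply Rmult_ge_compat_l; lra.
  - intros v Hv; rewrite dot_rsum_r; apply rsum_ext; intros j Hj; f_equal.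
    apply (is_proj_orthogonal N m h z); auto.
Qed.

(** * Positivity of balanced vectors *)

Lemma rsum_eq_0_nonneg (n : nat) (f : nat -> R) (i : nat) :
  (forall k, (k < n)%nat -> 0 <= f k) -> rsum n f = 0 -> (i < n)%nat -> f i = 0.
Proof.
  intros Hf Hs Hi; apply Rle_antisym; [|now apply Hf].
  rewrite <- Hs; now apply rsum_term_le.
Qed.

(** A zero spreads along arcs: if [u k = 0], balance at [k] is a vanishing sum of nonnegative terms
    [u l * A l k], so [u l = 0] wherever [A l k > 0]. *)
Lemma nonneg_balanced_vector_zero (N : nat) (A : nat -> nat -> R) (u : nat -> R) (j i : nat) :
  (forall i j, (i < N)%nat -> (j < N)%nat -> 0 <= A i j) ->
  (forall i, (i < N)%nat -> 0 <= u i) ->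
  (forall j, (j < N)%nat -> rsum N (fun i => u i * A i j) = u j * rsum N (A j)) ->
  reach (fun k l => (k < N)%nat /\ (l < N)%nat /\ A l k > 0) j i ->
  u j = 0 -> u i = 0.
Proof.
  intros HA Hu Hbal; induction 1 as [k|k l i (Hk & Hl & Hlk) _ IH]; intros Hz; [exact Hz|].
  apply IH; specialize (Hbal k Hk); rewrite Hz, Rmult_0_l in Hbal.
  assert (H0 : u l * A l k = 0).
  { apply (rsum_eq_0_nonneg N (fun i => u i * A i k)); auto.
    intros i' Hi'; apply Rmult_le_pos; auto. }
  apply Rmult_integral in H0; destruct H0; [assumption|lra].
Qed.

(* Perron-Frobenius: |w| is again balanced, hence so is the nonnegative vector
   |w| + w; strong connectivity makes the latter identically zero or positive. *)
Lemma balanced_vector_positive (N : nat) (A : nat -> nat -> R) (w : nat -> R) :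
  (forall i j, (i < N)%nat -> (j < N)%nat -> 0 <= A i j) ->
  (forall j, (j < N)%nat -> rsum N (fun i => w i * A i j) = w j * rsum N (A j)) ->
  strongly_connected N (fun j i => A i j > 0) -> rsum N w = 1 ->
  forall i, (i < N)%nat -> 0 < w i.
Proof.
  intros HA Hbal Hsc Hw1.
  assert (Habs : forall j, (j < N)%nat ->
            rsum N (fun i => Rabs (w i) * A i j) = Rabs (w j) * rsum N (A j)).
  (* The triangle inequality makes each defect nonnegative, and exchanging the sums shows that the
     defects add up to zero. *)
  { intros j Hj; apply Rminus_diag_uniq.
    apply (rsum_eq_0_nonneg N (fun j => rsum N (fun i => Rabs (w i) * A i j)
                                        - Rabs (w j) * rsum N (A j))); [| |exact Hj].
    - intros k Hk.
      assert (H : Rabs (w k) * rsum N (A k) = Rabs (rsum N (fun i => w i * A i k))).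
      { rewrite Hbal, Rabs_mult by exact Hk; f_equal; symmetry; apply Rabs_pos_eq.
        apply rsum_nonneg; intros; auto. }
      rewrite H; apply Rge_le, Rge_minus, Rle_ge; eapply Rle_trans; [apply rsum_abs|].
      apply rsum_le; intros i Hi; rewrite Rabs_mult, (Rabs_pos_eq (A i k)) by auto; lra.
    - rewrite rsum_minus, rsum_swap, <- rsum_minus; apply rsum_0; intros k _.
      rewrite rsum_scal; apply Rminus_diag. }
  set (u := fun i => Rabs (w i) + w i).
  assert (Hu : forall i, (i < N)%nat -> 0 <= u i).
  { intros i _; unfold u; pose proof (Rle_abs (- w i)) as H; rewrite Rabs_Ropp in H; lra. }
  assert (Hubal : forall j, (j < N)%nat -> rsum N (fun i => u i * A i j) = u j * rsum N (A j)).
  { intros j Hj; unfold u; rewrite Rmult_plus_distr_r, <- Habs, <- Hbal by exact Hj.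
    rewrite <- rsum_plus; apply rsum_ext; intros; ring. }
  (* A nonpositive entry is a zero of [u], so [u] vanishes everywhere and no entry of [w] is
     positive, against the sum being 1. *)
  intros i Hi; apply Rnot_le_lt; intros Hwi.
  assert (Hui : u i = 0) by (unfold u; rewrite Rabs_left1 by exact Hwi; ring).
  assert (Hall : rsum N w <= rsum N (fun _ => 0)).
  { apply rsum_le; intros k Hk.
    assert (Huk : u k = 0) by (apply (nonneg_balanced_vector_zero N A u i k); auto).
    unfold u in Huk; pose proof (Rabs_pos (w k)); lra. }
  rewrite rsum_const, Hw1 in Hall; lra.
Qed.

Lemma vec_lim_ext (m : nat) (f : R -> vec) (l l' : vec) :
  (forall k, (k < m)%nat -> l k = l' k) -> vec_lim m f l -> vec_lim m f l'.
Proof.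
  intros Hl H eps Heps; destruct (H eps Heps) as [T HT]; exists T; intros t Ht.
  replace (vnorm m (vsub (f t) l')) with (vnorm m (vsub (f t) l)); [now apply HT|].
  unfold vnorm; f_equal; apply rsum_ext; intros k Hk; unfold vsub; now rewrite Hl.
Qed.

Lemma reach_impl (Rel Rel' : nat -> nat -> Prop) (i j : nat) :
  (forall u v, Rel u v -> Rel' u v) -> reach Rel i j -> reach Rel' i j.
Proof.
  intros H; induction 1 as [i|i j k Hij _ IH]; [apply reach_refl|].
  now apply reach_step with j; [apply H|].
Qed.

Theorem theorem5 :
  forall (N m : nat) (h : nat -> vec) (z : nat -> R),
    (1 <= N)%nat -> (1 <= m)%nat ->
    (forall i, (i < N)%nat -> dot m (h i) (h i) = 1) ->
    (* Case (I) or (II): z is in the column space of H, i.e. A is nonempty *)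
    (exists y, inA N m h z y) ->
  forall (E : R -> nat -> nat -> bool) (a : nat -> nat -> R -> R) (astar : R),
    (* arcs join distinct nodes *)
    (forall t i, E t i i = false) ->
    (* Weights Assumption *)
    astar > 0 ->
    (forall i j t, (i < N)%nat -> (j < N)%nat -> t >= 0 -> 0 < a i j t <= astar) ->
    (forall i j, (i < N)%nat -> (j < N)%nat ->
       null_set (fun t => t >= 0 /\ ~ continuity_pt (a i j) t)) ->
    (* measurability of t |-> a_ij(t) 1_{(j,i) in E}: local integrability *)
    (forall i j t1 t2, (i < N)%nat -> (j < N)%nat -> 0 <= t1 -> t1 <= t2 ->
       exists I, HK_integral (arcw E a j i) t1 t2 I) ->
  forall (x : nat -> R -> vec),
    ((exists K, K > 0 /\ is_solution N m (cp_rhs N m h z K E a) x) \/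
     (is_solution N m (pc_rhs N m h z E a) x /\
      forall i, (i < N)%nat -> inAi m h z i (x i 0))) ->
  forall (p : nat -> vec),
    (* p j = P_A(x_j(0)) *)
    (forall j, (j < N)%nat -> is_proj m (inA N m h z) (x j 0) (p j)) ->
    (* (i) *)
    ((balanced N E a ->
      (exists delta, delta > 0 /\ (UJSC N E a delta \/ BIJC N E a delta)) ->
      forall i, (i < N)%nat ->
        vec_lim m (x i) (fun k => / INR N * rsum N (fun j => p j k)))
    /\
    (* (ii) *)
    (forall (ES : nat -> nat -> bool) (aS : nat -> nat -> R) (w : nat -> R),
      (forall t i j, t >= 0 -> E t i j = ES i j) ->
      (forall i j t, t >= 0 -> a i j t = aS i j) ->
      (forall i j, (i < N)%nat -> (j < N)%nat -> aS i j > 0) ->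
      strongly_connected N (fun j i => ES j i = true) ->
      rsum N w = 1 ->
      (forall j, (j < N)%nat -> rsum N (fun i => w i * laplS N ES aS i j) = 0) ->
      forall i, (i < N)%nat ->
        vec_lim m (x i) (fun k => rsum N (fun j => w j * p j k)))).
Proof.
  intros N m h z HN _ Hh _ E a astar _ Hastar Ha _ _ x Hflow p Hp; split.
  - intros Hbal (delta & Hdelta & Hconn) i Hi.
    assert (HN0 : 0 < INR N) by (apply lt_0_INR; lia).
    assert (Hcuts : exists d, d > 0 /\ joins_cuts N E a d).
    { destruct Hconn as [H|H].
      - exists delta; split; [exact Hdelta|now apply UJSC_joins_cuts].
      - exists (delta / 2); split; [lra|now apply BIJC_joins_cuts]. }
    destruct Hcuts as [d [Hd Hcuts]].
    apply (vec_lim_ext m _ (fun k => rsum N (fun j => / INR N * p j k))).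
    { intros k _; apply rsum_scal. }
    apply (flow_converges N m h z E a astar d x p (fun _ => / INR N)); auto.
    + intros; now apply Rinv_0_lt_compat.
    + rewrite rsum_const; apply Rinv_r; lra.
    + intros k t Hk Ht; rewrite rsum_scal; f_equal; now apply Hbal.
  - intros ES aS w HE HaS HaSpos Hsc Hw1 Hnull i Hi.
    assert (Harc : forall i j t, t >= 0 -> arcw E a j i t = adjS ES aS i j).
    { intros k l t Ht; unfold arcw, adjS; now rewrite HE, HaS. }
    (* The null vector equation, read column by column, is the balance of the weights
       [w i * adjS ES aS i j]. *)
    assert (Hbal : forall j, (j < N)%nat ->
      rsum N (fun i => w i * adjS ES aS i j) = w j * rsum N (adjS ES aS j)).
    { intros j Hj; specialize (Hnull j Hj); unfold laplS in Hnull.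
      rewrite (rsum_ext N _ (fun i =>
                 (if Nat.eqb i j then w i * rsum N (fun k => adjS ES aS i k) else 0)
                 - w i * adjS ES aS i j)) in Hnull.
      - rewrite rsum_minus, (rsum_delta N j (fun i => w i * rsum N (fun k => adjS ES aS i k)))
          in Hnull by exact Hj.
        symmetry; now apply Rminus_diag_uniq.
      - intros k _; destruct (Nat.eqb k j); ring. }
    assert (Hw : forall k, (k < N)%nat -> 0 < w k).
    { apply (balanced_vector_positive N (adjS ES aS)); auto.
      - intros k l Hk Hl; unfold adjS; destruct (ES l k); [|lra].
        apply Rlt_le, HaSpos; auto.
      - intros k l Hk Hl; apply reach_impl with (2 := Hsc k l Hk Hl).
        intros u v (Hu & Hv & HES); repeat split; auto.
        unfold adjS; rewrite HES; now apply HaSpos. }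
    apply (flow_converges N m h z E a astar 1 x p w); auto; try lra.
    + intros k t Hk Ht.
      rewrite (rsum_ext N _ (adjS ES aS k)) by (intros; now apply Harc).
      rewrite <- Hbal by exact Hk; apply rsum_ext; intros; now rewrite Harc.
    + intros s cl i0 j0 Hs Hi0 Hj0 Hne.
      destruct (reach_crosses _ cl _ _ (Hsc i0 j0 Hi0 Hj0) Hne)
        as (u & v & (Hu & Hv & HES) & Huv).
      assert (Hpos : 0 < / aS v u) by (apply Rinv_0_lt_compat, HaSpos; auto).
      (* A constant weight accumulates the required integral 1 over a window of length its
         inverse. *)
      exists v, u, (s + / aS v u); repeat split; auto; [lra|].
      exists (aS v u * (s + / aS v u - s)); split.
      * apply HK_integral_const; intros t Ht.
        rewrite Harc by lra; unfold adjS; now rewrite HES.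
      * right; specialize (HaSpos v u Hv Hu); field; lra.
Qed.
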